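(* Let $P\subseteq\mathbb{R}$ with the usual total order and let $K$ be a field. Let $M:P\to\mathbf{Vect}_K$ be a direct sum of interval modules (with arbitrary indexing set) and let $I$ be an interval module. Given a nonzero map $f:I\to M$, there exists an isomorphism $\theta:M\to N\oplus N'$ with either (1) $N'=\bigoplus_{j=1}^{n}M_j$ for some $n\ge1$, or (2) $N'=\bigoplus_{j=1}^{\infty}M_j$, such that $p_N\theta f=0$ and, for all $j$, $M_j$ is an interval module with $M_j\le I$, $M_j\cap I\ne\emptyset$, $p_j\theta f$ is nonzero, and the interval $M_j\cap I$ contains the interval $M_{j+1}\cap I$ (whenever $M_{j+1}$ is present); moreover: - In case (1), $M_1\Supset M_2\Supset\cdots\Supset M_n$, and if $I$ does not have a lower bound then $n=1$. - If $\inf I\in I$ then only case (1) can occur. - In case (2), $\lim_{j\to\infty}(\sup M_j)=\inf I$. - In both cases, $\ker f= I\setminus M_1$. - In case (1), $\operatorname{coker}f\cong N\oplus(M_n\setminus I)\oplus\bigoplus_{j=1}^{n-1}M_j\setminus\big((M_j\setminus M_{j+1})\cap I\big)$.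
   Context: $P$ is viewed as a category via $\le$; a persistence module is a functor $P\to\mathbf{Vect}_K$. An interval in $P$ is a nonempty convex subset. The interval module of an interval $I$, also denoted $I$, has value $K$ at points of $I$, $0$ elsewhere, and identity maps between points of $I$. Set-theoretic expressions such as $I\setminus M_1$, $M_j\cap I$, $M_n\setminus I$ refer to the corresponding subsets of $P$; when used as modules they denote the corresponding interval modules (the zero module if the set is empty). Persistence modules in this statement, including $N$, are understood to be isomorphic to direct sums of interval modules. The maps $p_N:N\oplus N'\to N$ and $p_j:N\oplus N'\to M_j$ are the canonical projections. For intervals $I,J\subseteq P$, $I\le J$ means: for all $i\in I$ there exists $j\in J$ with $i\le j$, and for all $j\in J$ there exists $i\in I$ with $i\le j$. Write $J\Supset I$ if $I\subset J$ and there exist $a,b\in J$ such that $a<i<b$ for all $i\in I$. *)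

(* Defs.v *)
From HB Require Import structures.
From mathcomp Require Import all_boot all_order all_algebra.
From mathcomp Require Import all_classical all_reals all_analysis.
Set Implicit Arguments.
Unset Strict Implicit.
Unset Printing Implicit Defensive.
Import Order.TTheory GRing.Theory Num.Theory.
Local Open Scope classical_set_scope.
Local Open Scope ring_scope.

(* [forall a, V a] with the pointwise module structure; MathComp only equips
   the non-dependent function type [A -> V]. *)
Definition dprod_type (K : pzRingType) (A : Type) (V : A -> lmodType K) : Type :=
  forall a, V a.

Section DirectProduct.
Variables (K : pzRingType) (A : Type) (V : A -> lmodType K).
Local Notation T := (dprod_type V).

HB.instance Definition _ := gen_eqMixin T.
HB.instance Definition _ := gen_choiceMixin T.

Definition dprod_zero : T := fun=> 0.
Definition dprod_opp (f : T) : T := fun a => - f a.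
Definition dprod_add (f g : T) : T := fun a => f a + g a.
Definition dprod_scale (k : K) (f : T) : T := fun a => k *: f a.

Fact dprod_addA : associative dprod_add.
Proof. by move=> f g h; apply: functional_extensionality_dep => a; exact: addrA. Qed.
Fact dprod_addC : commutative dprod_add.
Proof. by move=> f g; apply: functional_extensionality_dep => a; exact: addrC. Qed.
Fact dprod_add0 : left_id dprod_zero dprod_add.
Proof. by move=> f; apply: functional_extensionality_dep => a; exact: add0r. Qed.
Fact dprod_addN : left_inverse dprod_zero dprod_opp dprod_add.
Proof. by move=> f; apply: functional_extensionality_dep => a; exact: addNr. Qed.

HB.instance Definition _ :=
  GRing.isZmodule.Build T dprod_addA dprod_addC dprod_add0 dprod_addN.

Fact dprod_scaleA k l (f : T) :
  dprod_scale k (dprod_scale l f) = dprod_scale (k * l) f.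
Proof. by apply: functional_extensionality_dep => a; exact: scalerA. Qed.
Fact dprod_scale1 : left_id 1 dprod_scale.
Proof. by move=> f; apply: functional_extensionality_dep => a; exact: scale1r. Qed.
Fact dprod_scaleDr : right_distributive dprod_scale +%R.
Proof. by move=> k f g; apply: functional_extensionality_dep => a; exact: scalerDr. Qed.
Fact dprod_scaleDl (f : T) : {morph dprod_scale^~ f : k l / k + l}.
Proof. by move=> k l; apply: functional_extensionality_dep => a; exact: scalerDl. Qed.

HB.instance Definition _ := GRing.Zmodule_isLmodule.Build K T
  dprod_scaleA dprod_scale1 dprod_scaleDr dprod_scaleDl.

Definition dsum_pred : {pred T} :=
  fun f => `[< finite_set [set a | f a != 0] >].

Fact dsum_pred_closed : submod_closed dsum_pred.
Proof.
split.
  by apply/asboolP; rewrite (_ : [set a | _] = set0)//; apply/seteqP; split=> a //=;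
    rewrite eqxx.
move=> k f g /asboolP ff /asboolP fg; apply/asboolP.
apply: (@sub_finite_set _ _ ([set a | f a != 0] `|` [set a | g a != 0])); last first.
  by rewrite finite_setU.
move=> a /= h; case: (eqVneq (f a) 0) => [fa0|]; last by left.
right; apply: contra_neq h => ga0.
by rewrite -[LHS]/(k *: f a + g a) fa0 ga0 scaler0 addr0.
Qed.

HB.instance Definition _ :=
  GRing.isSubmodClosed.Build K T dsum_pred dsum_pred_closed.

Record dsum_type := DSum { dsum_val : T ; dsum_valP : dsum_val \in dsum_pred }.

HB.instance Definition _ := [isSub for dsum_val].
HB.instance Definition _ := [Choice of dsum_type by <:].
HB.instance Definition _ := [SubChoice_isSubLmodule of dsum_type by <:].

Definition dsum_coord (a : A) (f : dsum_type) : V a := dsum_val f a.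

Fact dsum_coord_linear a : linear (dsum_coord a).
Proof. by []. Qed.

HB.instance Definition _ a :=
  GRing.isLinear.Build K dsum_type (V a) *:%R (dsum_coord a) (dsum_coord_linear a).

End DirectProduct.

Section DirectSumMap.
Variables (K : pzRingType) (A : Type) (V W : A -> lmodType K).
Variable h : forall a, {linear V a -> W a}.

Fact dsum_map_subproof (f : dsum_type V) :
  ((fun a => h a (dsum_coord a f)) : dprod_type W) \in dsum_pred (V := W).
Proof.
apply/asboolP; have /asboolP ff := dsum_valP f.
apply: (sub_finite_set _ ff) => a /=; rewrite /dsum_coord; apply: contra_neq => ->; exact: linear0.
Qed.

Definition dsum_map (f : dsum_type V) : dsum_type W := DSum (dsum_map_subproof f).

Fact dsum_map_linear : linear dsum_map.
Proof.
move=> k f g; apply: val_inj; apply: functional_extensionality_dep => a.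
exact: linearP.
Qed.

HB.instance Definition _ :=
  GRing.isLinear.Build K (dsum_type V) (dsum_type W) *:%R dsum_map dsum_map_linear.

End DirectSumMap.

Section PairMap.
Variables (K : pzRingType) (U V U' V' : lmodType K).
Variables (f : {linear U -> U'}) (g : {linear V -> V'}).

Definition pair_map (x : U * V) : U' * V' := (f x.1, g x.2).

Fact pair_map_linear : linear pair_map.
Proof. by move=> k x y; rewrite /pair_map /= !linearP. Qed.

HB.instance Definition _ :=
  GRing.isLinear.Build K (U * V)%type (U' * V')%type *:%R pair_map pair_map_linear.

End PairMap.

Section KernelCokernel.
Variables (K : pzRingType) (U V : lmodType K) (f : {linear U -> V}).

Definition lker_pred : {pred U} := fun x => f x == 0.

Fact lker_pred_closed : submod_closed lker_pred.
Proof.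
split; first by rewrite unfold_in linear0.
by move=> k x y; rewrite !unfold_in linearP => /eqP-> /eqP->; rewrite scaler0 addr0.
Qed.

HB.instance Definition _ := GRing.isSubmodClosed.Build K U lker_pred lker_pred_closed.

Record lker_type := LKer { lker_val : U ; lker_valP : lker_val \in lker_pred }.

HB.instance Definition _ := [isSub for lker_val].
HB.instance Definition _ := [Choice of lker_type by <:].
HB.instance Definition _ := [SubChoice_isSubLmodule of lker_type by <:].

Definition lim_pred : {pred V} := fun y => `[< exists x, f x = y >].

Fact lim_pred_closed : submod_closed lim_pred.
Proof.
split; first by apply/asboolP; exists 0; rewrite linear0.
move=> k y z /asboolP[x <-] /asboolP[x' <-].
by apply/asboolP; exists (k *: x + x'); rewrite linearP.
Qed.

HB.instance Definition _ := GRing.isSubmodClosed.Build K V lim_pred lim_pred_closed.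

Definition lcoker_type : Type := Quotient.quot lim_pred.
HB.instance Definition _ := GRing.Zmodule.on lcoker_type.

Definition lcoker_pi (y : V) : lcoker_type := (\pi_(Quotient.quot lim_pred) y)%qT.

Fact lcoker_piB : {morph lcoker_pi : y z / y - z}.
Proof. exact: raddfB. Qed.

Fact lcoker_piD : {morph lcoker_pi : y z / y + z}.
Proof. exact: raddfD. Qed.

Lemma lcoker_piE y z : lcoker_pi y = lcoker_pi z <-> exists x, f x = y - z.
Proof.
split=> [e|e].
  by apply/asboolP; rewrite -/(lim_pred _) -[lim_pred _]/(_ \in lim_pred)
    Quotient.idealrBE; apply/eqP.
by apply/eqP; rewrite -Quotient.idealrBE; apply/asboolP.
Qed.

Definition lcoker_repr (y : lcoker_type) : V := repr (y : Quotient.quot lim_pred).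

Lemma lcoker_reprK : cancel lcoker_repr lcoker_pi.
Proof. by move=> y; exact: reprK. Qed.

Definition lcoker_scale (k : K) (y : lcoker_type) : lcoker_type :=
  lcoker_pi (k *: lcoker_repr y).

Fact lcoker_piZ k y : lcoker_scale k (lcoker_pi y) = lcoker_pi (k *: y).
Proof.
apply/lcoker_piE.
have /lcoker_piE[x fx] := lcoker_reprK (lcoker_pi y).
by exists (k *: x); rewrite linearZ /= fx scalerBr.
Qed.

Fact lcoker_scaleA k l y : lcoker_scale k (lcoker_scale l y) = lcoker_scale (k * l) y.
Proof. by rewrite -[y]lcoker_reprK !lcoker_piZ scalerA. Qed.
Fact lcoker_scale1 : left_id 1 lcoker_scale.
Proof. by move=> y; rewrite -[y]lcoker_reprK lcoker_piZ scale1r. Qed.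
Fact lcoker_scaleDr : right_distributive lcoker_scale +%R.
Proof.
move=> k y z; rewrite -[y]lcoker_reprK -[z]lcoker_reprK -lcoker_piD !lcoker_piZ.
by rewrite scalerDr lcoker_piD.
Qed.
Fact lcoker_scaleDl y : {morph lcoker_scale^~ y : k l / k + l}.
Proof.
by move=> k l; rewrite -[y]lcoker_reprK !lcoker_piZ scalerDl lcoker_piD.
Qed.

HB.instance Definition _ := GRing.Zmodule_isLmodule.Build K lcoker_type
  lcoker_scaleA lcoker_scale1 lcoker_scaleDr lcoker_scaleDl.

Fact lcoker_pi_linear : linear lcoker_pi.
Proof. by move=> k y z; rewrite lcoker_piD -lcoker_piZ. Qed.

HB.instance Definition _ :=
  GRing.isLinear.Build K V lcoker_type *:%R lcoker_pi lcoker_pi_linear.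

End KernelCokernel.

Section KernelCokernelMap.
Variables (K : pzRingType) (U V U' V' : lmodType K).
Variables (f : {linear U -> V}) (f' : {linear U' -> V'}).
Variables (u : {linear U -> U'}) (v : {linear V -> V'}).
Hypothesis vf : forall x, v (f x) = f' (u x).

Fact lker_map_subproof (x : lker_type f) : u (val x) \in lker_pred f'.
Proof. by rewrite unfold_in -vf (eqP (valP x)) linear0. Qed.

Definition lker_map (x : lker_type f) : lker_type f' := LKer (lker_map_subproof x).

Fact lker_map_linear : linear lker_map.
Proof. by move=> k x y; apply: val_inj; rewrite /= !linearP. Qed.

HB.instance Definition _ :=
  GRing.isLinear.Build K (lker_type f) (lker_type f') *:%R lker_map lker_map_linear.

(* The commutation hypothesis is kept as an argument so that the canonical
   linear structure on [lcoker_map] can be inferred. *)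
Definition lcoker_map of (forall x, v (f x) = f' (u x)) :=
  fun y : lcoker_type f => lcoker_pi f' (v (lcoker_repr y)).

Lemma lcoker_map_pi y : lcoker_map vf (lcoker_pi f y) = lcoker_pi f' (v y).
Proof.
apply/lcoker_piE.
have /lcoker_piE[x fx] := lcoker_reprK (lcoker_pi f y).
by exists (u x); rewrite -vf fx linearB.
Qed.

Fact lcoker_map_linear : linear (lcoker_map vf).
Proof.
move=> k y z; rewrite -[y]lcoker_reprK -[z]lcoker_reprK -linearP !lcoker_map_pi.
by rewrite !linearP.
Qed.

HB.instance Definition _ := GRing.isLinear.Build K (lcoker_type f) (lcoker_type f')
  *:%R (lcoker_map vf) lcoker_map_linear.

End KernelCokernelMap.

Record pmod (K : fieldType) d (T : porderType d) := PMod {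
  pm_obj :> T -> lmodType K ;
  pm_map : forall p q : T, (p <= q)%O -> {linear pm_obj p -> pm_obj q} ;
  pm_map_id : forall p (h : (p <= p)%O) x, pm_map h x = x ;
  pm_map_comp : forall p q r (hpq : (p <= q)%O) (hqr : (q <= r)%O) (hpr : (p <= r)%O) x,
    pm_map hqr (pm_map hpq x) = pm_map hpr x }.

Record pmor (K : fieldType) d (T : porderType d) (M N : pmod K T) := PMor {
  pm_app :> forall p : T, {linear M p -> N p} ;
  pm_natural : forall p q (h : (p <= q)%O) x,
    pm_app q (pm_map M h x) = pm_map N h (pm_app p x) }.

Section PersistenceModules.
Variables (K : fieldType) (d : Order.disp_t) (T : porderType d).
Implicit Types (L M N : pmod K T).

Program Definition pm_comp L M N (g : pmor M N) (f : pmor L M) : pmor L N :=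
  @PMor _ _ _ L N (fun p => g p \o f p : {linear L p -> N p}) _.
Next Obligation. by move=> L M N g f p q h x /=; rewrite !pm_natural. Qed.

Definition pm_nonzero M N (f : pmor M N) : Prop := exists p x, f p x != 0.

Definition pm_is_iso M N (f : pmor M N) : Prop :=
  exists g : pmor N M, forall p, cancel (f p) (g p) /\ cancel (g p) (f p).

Definition pm_iso M N : Prop := exists f : pmor M N, pm_is_iso f.

Program Definition pm_sum M N : pmod K T :=
  @PMod _ _ _ (fun p => (M p * N p)%type : lmodType K)
    (fun p q h => pair_map (pm_map M h) (pm_map N h)) _ _.
Next Obligation. by move=> M N p h [x y]; rewrite /= /pair_map /= !pm_map_id. Qed.
Next Obligation.
by move=> M N p q r hpq hqr hpr [x y]; rewrite /= /pair_map /= !(pm_map_comp _ _ hpr).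
Qed.

Program Definition pm_fst M N : pmor (pm_sum M N) M :=
  @PMor _ _ _ (pm_sum M N) M (fun p => fst : {linear (M p * N p)%type -> M p}) _.
Next Obligation. by []. Qed.

Program Definition pm_snd M N : pmor (pm_sum M N) N :=
  @PMor _ _ _ (pm_sum M N) N (fun p => snd : {linear (M p * N p)%type -> N p}) _.
Next Obligation. by []. Qed.

Program Definition pm_dsum (A : Type) (F : A -> pmod K T) : pmod K T :=
  @PMod _ _ _ (fun p => dsum_type (fun a => F a p))
    (fun p q h => dsum_map (fun a => pm_map (F a) h)) _ _.
Next Obligation.
move=> A F p h x; apply: val_inj; apply: functional_extensionality_dep => a.
exact: pm_map_id.
Qed.
Next Obligation.
move=> A F p q r hpq hqr hpr x; apply: val_inj.
by apply: functional_extensionality_dep => a; exact: pm_map_comp.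
Qed.

Program Definition pm_proj (A : Type) (F : A -> pmod K T) (a : A) :
    pmor (pm_dsum F) (F a) :=
  @PMor _ _ _ (pm_dsum F) (F a) (fun p => @dsum_coord K A (fun a => F a p) a) _.
Next Obligation. by []. Qed.

Program Definition pm_ker M N (f : pmor M N) : pmod K T :=
  @PMod _ _ _ (fun p => lker_type (f p))
    (fun p q h => lker_map (fun x => esym (pm_natural f h x))) _ _.
Next Obligation. by move=> M N f p h x; apply: val_inj; exact: pm_map_id. Qed.
Next Obligation.
by move=> M N f p q r hpq hqr hpr x; apply: val_inj; exact: pm_map_comp.
Qed.

Program Definition pm_coker M N (f : pmor M N) : pmod K T :=
  @PMod _ _ _ (fun p => lcoker_type (f p))
    (fun p q h => lcoker_map (fun x => esym (pm_natural f h x))) _ _.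
Next Obligation.
by move=> M N f p h x; rewrite -[x]lcoker_reprK /= lcoker_map_pi pm_map_id.
Qed.
Next Obligation.
move=> M N f p q r hpq hqr hpr x; rewrite -[x]lcoker_reprK /= !lcoker_map_pi.
by rewrite (pm_map_comp _ _ hpr).
Qed.

Program Definition pm_ker_incl M N (f : pmor M N) : pmor (pm_ker f) M :=
  @PMor _ _ _ (pm_ker f) M (fun p => val : {linear lker_type (f p) -> M p}) _.
Next Obligation. by []. Qed.

End PersistenceModules.

Section Intervals.
Variables (d : Order.disp_t) (T : porderType d).
Implicit Types S I J : set T.

(* The empty set is allowed: it gives the zero module. *)
Definition convex_set S : Prop :=
  forall p q r, S p -> S r -> (p <= q)%O -> (q <= r)%O -> S q.

Record convexset := ConvexSet { convex_val :> set T ; convexP : convex_set convex_val }.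

Record pinterval := PInterval {
  interval_val :> convexset ; interval_neq0 : (interval_val : set T) !=set0 }.

Definition set_le I J : Prop :=
  (forall i, I i -> exists2 j, J j & (i <= j)%O) /\
  (forall j, J j -> exists2 i, I i & (i <= j)%O).

(* [set_Supset J I] is the relation written J \Supset I. *)
Definition set_Supset J I : Prop :=
  I `<=` J /\ exists a b, [/\ J a, J b & forall i, I i -> (a < i)%O /\ (i < b)%O].

Definition has_lower_bound I : Prop := exists p, forall i, I i -> (p <= i)%O.

End Intervals.

Section IntervalModules.
Variables (K : fieldType) (d : Order.disp_t) (T : porderType d).

Definition imod_obj (b : bool) : lmodType K :=
  if b then (K^o : lmodType K) else ('rV[K]_0 : lmodType K).

Definition imod_map (b c : bool) : {linear imod_obj b -> imod_obj c} :=
  match b, c return {linear imod_obj b -> imod_obj c} with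
  | true, true => idfun
  | _, _ => \0
  end.

(* Convexity is what makes the transition maps compose. *)
Program Definition interval_mod (S : convexset T) : pmod K T :=
  @PMod _ _ _ (fun p => imod_obj `[< (S : set T) p >])
    (fun p q _ => imod_map `[< (S : set T) p >] `[< (S : set T) q >]) _ _.
Next Obligation.
move=> S p _ x /=; case: asboolP x => _ x //=.
by apply/matrixP => i [].
Qed.
Next Obligation.
move=> S p q r hpq hqr _ x /=.
case: (asboolP ((S : set T) p)) x => [Sp|_] x; case: (asboolP ((S : set T) q)) => [//|nSq];
  case: (asboolP ((S : set T) r)) => //= Sr.
by case: nSq; exact: convexP Sp Sr hpq hqr.
Qed.

Definition interval_decomposable (M : pmod K T) : Prop :=
  exists (A : Type) (J : A -> pinterval T), pm_iso M (pm_dsum (fun a => interval_mod (J a))).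

(* [ker f = D] as submodules of [I]: an isomorphism between [D] and the kernel
   that is compatible with the inclusions into [I]. *)
Definition pm_ker_eq (I : pinterval T) (M : pmod K T) (f : pmor (interval_mod I) M)
    (D : convexset T) : Prop :=
  exists phi : pmor (interval_mod D) (pm_ker f),
    pm_is_iso phi /\
    forall p (x : interval_mod D p),
      pm_ker_incl f p (phi p x) =
      imod_map `[< (D : set T) p >] `[< (I : set T) p >] x.

(* The conditions common to the finite and the countably infinite case.  The
   index [j : A] stands for the summand M_(1 + rank j): it is used with
   [A = 'I_n.+1] for n+1 summands and with [A = nat] for infinitely many. *)
Definition splitting (A : Type) (rank : A -> nat) (I : pinterval T) (M : pmod K T)
    (f : pmor (interval_mod I) M) (N : pmod K T) (Mj : A -> pinterval T)
    (theta : pmor M (pm_sum N (pm_dsum (fun j => interval_mod (Mj j))))) : Prop :=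
  [/\ interval_decomposable N,
      pm_is_iso theta,
      forall p x, pm_comp (pm_fst _ _) (pm_comp theta f) p x = 0,
      forall j, [/\ set_le (Mj j) I, (Mj j : set T) `&` I !=set0 &
        pm_nonzero (pm_comp (pm_comp (pm_proj _ j) (pm_snd _ _)) (pm_comp theta f))] &
      forall j k, rank k = (rank j).+1 ->
        (Mj k : set T) `&` I `<=` (Mj j : set T) `&` I].

End IntervalModules.

Arguments interval_mod K {d T} S.

Section Subsets.
Variables (R : realType) (P : set R).

HB.instance Definition _ := SubChoice.on (set_type P).
HB.instance Definition _ := [SubChoice_isSubOrder of set_type P by <: with ring_display].

(* Taken in the extended reals, since [S] may be unbounded. *)
Definition set_sup (S : set (set_type P)) : \bar R :=
  ereal_sup [set (\val p)%:E | p in S].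
Definition set_inf (S : set (set_type P)) : \bar R :=
  ereal_inf [set (\val p)%:E | p in S].

Definition inf_attained (S : set (set_type P)) : Prop :=
  exists2 p, S p & set_inf S = (\val p)%:E.

End Subsets.

(* Main.v *)
Require Import Defs.
From HB Require Import structures.
From mathcomp Require Import all_boot all_order all_algebra.
From mathcomp Require Import all_classical all_reals all_analysis.
From mathcomp Require Import zify.
Set Implicit Arguments.
Unset Strict Implicit.
Unset Printing Implicit Defensive.
Import Order.TTheory GRing.Theory Num.Theory.
Local Open Scope classical_set_scope.
Local Open Scope ring_scope.

(* A nonzero map I -> J of interval modules over a total order is a scalar, and
   exists iff J <= I and J meets I; so f : I -> M is a family of scalars (c_a),
   one for each summand J_a of M.  Where c_a <> 0 the sets J_a ∩ I are nonempty
   initial segments of I, hence form a chain, and each point of I lies in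
   finitely many of them.

   If infinitely many c_a are nonzero, the corresponding summands can thus be
   listed by decreasing J_a ∩ I; this is case (2), without change of basis.

   If only finitely many are nonzero, choose a maximal antichain for the preorder
   J_a <= J_b among them.  A summand J_a <= J_b with J_b in the antichain receives
   a map from J_b, so subtracting (c_a / c_b) times the b-coordinate from the
   a-coordinate is an automorphism of M that kills c_a.  The survivors, sorted by
   J_a ∩ I, are pairwise incomparable, which is exactly strict nesting at both
   ends.  The cokernel is read off from the coordinates x_j / c_j - x_(j+1) / c_(j+1)
   and x_n / c_n, which vanish precisely on multiples of c. *)

Lemma sval_inj (A : Type) (Q : A -> Prop) : injective (@sval A Q).
Proof. by move=> [a h] [b h'] /= ab; subst b; congr exist; exact: Prop_irrelevance. Qed.

(** * Morphisms of persistence modules *)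

Section Morphisms.
Variables (K : fieldType) (d : Order.disp_t) (T : porderType d).
Implicit Types (L M N : pmod K T).

Lemma pm_iso_refl M : pm_iso M M.
Proof.
pose u : pmor M M := @PMor _ _ _ M M (fun p => idfun : {linear M p -> M p})
  (fun p q h x => erefl).
by exists u; exists u.
Qed.

Lemma pm_comp_iso L M N (g : pmor M N) (f : pmor L M) :
  pm_is_iso g -> pm_is_iso f -> pm_is_iso (pm_comp g f).
Proof.
move=> [g' gK] [f' fK]; exists (pm_comp f' g') => p.
have [gK1 gK2] := gK p; have [fK1 fK2] := fK p.
by split=> x /=; rewrite ?gK1 ?fK2 ?fK1 ?gK2.
Qed.

(** Choice supplies pointwise inverses; their linearity and naturality follow by cancelling the
    injective [f]. *)
Lemma pm_bij_is_iso M N (f : pmor M N) :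
  (forall p, injective (f p)) -> (forall p y, exists x, f p x = y) ->
  pm_is_iso f.
Proof.
move=> finj fsur; pose g p y : M p := projT1 (cid (fsur p y)).
have gK p : cancel (g p) (f p) by move=> y; exact: projT2 (cid (fsur p y)).
have gl p : linear (g p).
  by move=> k x y; apply: (finj p); rewrite linearP !gK.
pose gL p : {linear N p -> M p} :=
  HB.pack (g p) (GRing.isLinear.Build K (N p) (M p) *:%R (g p) (gl p)).
have gn p q (h : (p <= q)%O) x : gL q (pm_map N h x) = pm_map M h (gL p x).
  by apply: (finj q); rewrite pm_natural /= !gK.
exists (PMor gn) => p; split=> x /=; last exact: gK.
by apply: (finj p); rewrite gK.
Qed.

Section Factorization.
Variables (L M N : pmod K T) (f : pmor L M) (g : pmor M N).

(** First isomorphism theorem: [g], evaluated on representatives, descends to the cokernel because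
    it kills the image of [f]. *)
Lemma pm_coker_iso :
  (forall p y, exists x, g p x = y) ->
  (forall p x, g p x = 0 <-> exists y, f p y = x) ->
  pm_iso (pm_coker f) N.
Proof.
move=> gsur gker.
pose h p (y : pm_coker f p) : N p := g p (lcoker_repr y).
have hpi p x : h p (lcoker_pi (f p) x) = g p x.
  apply/eqP; rewrite -subr_eq0 /h -linearB; apply/eqP/gker/lcoker_piE.
  exact: lcoker_reprK.
have hl p : linear (h p).
  move=> k x y; rewrite -[x in LHS]lcoker_reprK -[y in LHS]lcoker_reprK -linearP.
  by rewrite hpi linearP.
pose hL p : {linear pm_coker f p -> N p} :=
  HB.pack (h p) (GRing.isLinear.Build K (pm_coker f p) (N p) *:%R (h p) (hl p)).
have hn p q (u : (p <= q)%O) x : hL q (pm_map (pm_coker f) u x) = pm_map N u (hL p x).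
  rewrite -[x]lcoker_reprK /= lcoker_map_pi.
  by rewrite !hpi pm_natural.
exists (PMor hn); apply: pm_bij_is_iso => p /=.
  move=> x y; rewrite -[x]lcoker_reprK -[y]lcoker_reprK !hpi => e.
  by apply/lcoker_piE/gker; rewrite linearB e subrr.
by move=> y; have [x gx] := gsur p y; exists (lcoker_pi (f p) x); rewrite /= hpi.
Qed.

End Factorization.

Program Definition pm_add M N (f g : pmor M N) : pmor M N :=
  @PMor _ _ _ M N (fun p => f p \+ g p : {linear M p -> N p}) _.
Next Obligation. by move=> M N f g p q h x /=; rewrite !pm_natural linearD. Qed.

Section Pairing.
Variables (L M N : pmod K T) (f : pmor L M) (g : pmor L N).

Definition pm_pair_app p (x : L p) : pm_sum M N p := (f p x, g p x).

Fact pm_pair_linear p : linear (@pm_pair_app p).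
Proof. by move=> k x y; rewrite /pm_pair_app !linearP. Qed.

HB.instance Definition _ p := GRing.isLinear.Build K (L p) (pm_sum M N p) *:%R
  (@pm_pair_app p) (@pm_pair_linear p).

Program Definition pm_pair : pmor L (pm_sum M N) :=
  @PMor _ _ _ L (pm_sum M N) (fun p => @pm_pair_app p) _.
Next Obligation. by move=> p q h x; rewrite /= /pm_pair_app !pm_natural. Qed.

End Pairing.

Section DirectSumLift.
Variables (A : Type) (M : pmod K T) (F : A -> pmod K T).
Variable g : forall a, pmor M (F a).
Hypothesis gfin : forall p x, finite_set [set a | g a p x != 0].

Fact pm_dsum_lift_subproof p x :
  (fun a => g a p x) \in dsum_pred (V := fun a => F a p).
Proof. exact/asboolP/gfin. Qed.

Definition pm_dsum_lift_app p (x : M p) : pm_dsum F p :=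
  DSum (pm_dsum_lift_subproof x).

Fact pm_dsum_lift_linear p : linear (@pm_dsum_lift_app p).
Proof.
by move=> k x y; apply: val_inj; apply: functional_extensionality_dep => a;
  exact: linearP.
Qed.

HB.instance Definition _ p := GRing.isLinear.Build K (M p) (pm_dsum F p) *:%R
  (@pm_dsum_lift_app p) (@pm_dsum_lift_linear p).

Program Definition pm_dsum_lift : pmor M (pm_dsum F) :=
  @PMor _ _ _ M (pm_dsum F) (fun p => @pm_dsum_lift_app p) _.
Next Obligation.
move=> p q h x; apply: val_inj; apply: functional_extensionality_dep => a.
exact: pm_natural.
Qed.

End DirectSumLift.

End Morphisms.

(** * Interval modules in coordinates *)

Section Coordinates.
Variables (K : fieldType).

(** The type of a fibre depends on a boolean. Embedding every fibre into [K] turns equations between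
    fibres into equations between scalars, without casts. *)
Definition imod_coord (b : bool) (x : imod_obj K b) : K := imod_map K b true x.

Lemma imod_coordP b k (x y : imod_obj K b) :
  imod_coord (k *: x + y) = k * imod_coord x + imod_coord y.
Proof. by rewrite /imod_coord linearP. Qed.

Lemma imod_coord0 b : imod_coord (0 : imod_obj K b) = 0.
Proof. by rewrite /imod_coord linear0. Qed.

Lemma imod_coordZ b k (x : imod_obj K b) : imod_coord (k *: x) = k * imod_coord x.
Proof. by rewrite -[k *: x]addr0 imod_coordP imod_coord0 addr0. Qed.

Lemma imod_coordD b (x y : imod_obj K b) :
  imod_coord (x + y) = imod_coord x + imod_coord y.
Proof. by rewrite -[x]scale1r imod_coordP mul1r scale1r. Qed.

Lemma imod_coord_inj b : injective (@imod_coord b).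
Proof. by case: b => x y // _; apply/matrixP => i []. Qed.

Lemma imod_coord_out P (x : imod_obj K `[< P >]) : imod_coord x != 0 -> P.
Proof. by case: asboolP x => //= _ x; rewrite /imod_coord/= eqxx. Qed.

Lemma imod_coord_out0 P (x : imod_obj K `[< P >]) : ~ P -> imod_coord x = 0.
Proof. by move=> nP; apply/eqP/negPn/negP => /imod_coord_out. Qed.

Definition imod_scalar (b : bool) (k : K) : imod_obj K b := imod_map K true b k.

Lemma imod_scalarK b k : imod_coord (imod_scalar b k) = if b then k else 0.
Proof. by case: b => /=. Qed.

Lemma imod_scalarT (P : Prop) k : P -> imod_coord (imod_scalar `[< P >] k) = k.
Proof. by move=> p; rewrite imod_scalarK asboolT. Qed.

Lemma imod_scalarF (P : Prop) k : ~ P -> imod_coord (imod_scalar `[< P >] k) = 0.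
Proof. by move=> p; rewrite imod_scalarK asboolF. Qed.

Lemma imod_coord_map b c (x : imod_obj K b) :
  imod_coord (imod_map K b c x) = if c then imod_coord x else 0.
Proof. by case: b c x => [] [] x //=; rewrite /imod_coord/= ?linear0. Qed.

Lemma imod_coord_mapT b (P : Prop) (x : imod_obj K b) :
  P -> imod_coord (imod_map K b `[< P >] x) = imod_coord x.
Proof. by move=> p; rewrite imod_coord_map asboolT. Qed.

Lemma imod_coord_mapF b (P : Prop) (x : imod_obj K b) :
  ~ P -> imod_coord (imod_map K b `[< P >] x) = 0.
Proof. by move=> p; rewrite imod_coord_map asboolF. Qed.

End Coordinates.

Section IntervalMaps.
Variables (K : fieldType) (d : Order.disp_t) (T : porderType d).
Implicit Types S J : convexset T.

(* The condition under which a nonzero scalar gives a natural transformation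
   between interval modules. *)
Definition hom_ok S J : Prop :=
  forall p q, convex_val S p -> convex_val J q -> (p <= q)%O ->
    (convex_val J p <-> convex_val S q).

Section Scalar.
Variables (S J : convexset T) (k : K).
Hypothesis ok : k != 0 -> hom_ok S J.

Definition imor_app p (x : interval_mod K S p) : interval_mod K J p :=
  imod_scalar `[< convex_val J p >] (k * imod_coord x).

Fact imor_linear p : linear (@imor_app p).
Proof.
move=> l x y; apply: imod_coord_inj; rewrite imod_coordP !imod_scalarK imod_coordP.
by case: ifP => _; rewrite ?mulr0 ?addr0// mulrDr mulrCA.
Qed.

HB.instance Definition _ p := GRing.isLinear.Build K
  (interval_mod K S p) (interval_mod K J p) *:%R (@imor_app p) (@imor_linear p).

Program Definition imor : pmor (interval_mod K S) (interval_mod K J) :=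
  @PMor _ _ _ (interval_mod K S) (interval_mod K J) (fun p => @imor_app p) _.
Next Obligation.
move=> p q h x; apply: imod_coord_inj.
rewrite /= imod_coord_map !imod_scalarK imod_coord_map.
have [->|k0] := eqVneq k 0; first by rewrite !mul0r !if_same.
have [->|x0] := eqVneq (imod_coord x) 0; first by rewrite if_same mulr0 !if_same.
have Sp := imod_coord_out x0.
(* The two sides now differ only in testing [q] in [S] against [p] in [J], and [hom_ok] equates
   these tests. *)
case: (asboolP (convex_val J q)) => // Jq; have [JS SJ] := ok k0 Sp Jq h.
case: (asboolP (convex_val J p)) => [/JS Sq|nJp]; first by rewrite asboolT.
by rewrite asboolF ?mulr0// => /SJ.
Qed.

Lemma imorE p x : imod_coord (imor p x) = if `[< convex_val J p >] then k * imod_coord x else 0.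
Proof. exact: imod_scalarK. Qed.

End Scalar.

Section SumCoordinates.
Variables (A : Type) (J : A -> convexset T).
Local Notation sumJ := (pm_dsum (fun a => interval_mod K (J a))).

Definition sum_coord p (x : sumJ p) (a : A) : K := imod_coord (pm_proj _ a p x).

Lemma sum_coord_inj p (x y : sumJ p) : sum_coord x =1 sum_coord y -> x = y.
Proof.
move=> e; apply: val_inj; apply: functional_extensionality_dep => a.
exact: imod_coord_inj (e a).
Qed.

Lemma sum_coord0 p a : sum_coord (0 : sumJ p) a = 0.
Proof. by rewrite /sum_coord linear0 imod_coord0. Qed.

Lemma sum_coord_out p (x : sumJ p) a : sum_coord x a != 0 -> convex_val (J a) p.
Proof. by move=> /imod_coord_out. Qed.

Lemma sum_coord_out0 p (x : sumJ p) a : ~ convex_val (J a) p -> sum_coord x a = 0.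
Proof. exact: imod_coord_out0. Qed.

Lemma sum_coord_fin p (x : sumJ p) : finite_set [set a | sum_coord x a != 0].
Proof.
have /asboolP := dsum_valP x; apply: sub_finite_set => a /=.
by apply: contra_neq => e; rewrite /sum_coord /= /dsum_coord e imod_coord0.
Qed.

Lemma sum_coord_ex p (g : A -> K) : finite_set [set a | g a != 0] ->
  (forall a, g a != 0 -> convex_val (J a) p) ->
  exists x : sumJ p, forall a, sum_coord x a = g a.
Proof.
move=> gfin gJ.
have ok : (fun a => imod_scalar `[< convex_val (J a) p >] (g a))
    \in dsum_pred (V := fun a => interval_mod K (J a) p).
  apply/asboolP; apply: sub_finite_set gfin => a /=; apply: contra_neq => ->.
  by rewrite /imod_scalar linear0.
exists (DSum ok) => a; rewrite /sum_coord /= /dsum_coord /= imod_scalarK.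
by case: asboolP => // nJ; apply/eqP; rewrite eq_sym; apply/negPn/negP => /gJ.
Qed.

End SumCoordinates.

End IntervalMaps.

Section IntervalMorphisms.
Variables (K : fieldType) (d : Order.disp_t) (T : orderType d).
Implicit Types S J : convexset T.

(** Both directions are convexity: [S] has a point above [q], and [J] has a point below [p]. *)
Lemma set_le_hom_ok S J : set_le J S -> hom_ok S J.
Proof.
move=> [JS SJ] p q Sp Jq pq; split=> [Jp|Sq].
  by have [s Ss qs] := JS q Jq; exact: convexP Sp Ss pq qs.
by have [j Jj jp] := SJ p Sp; exact: convexP Jj Jq jp pq.
Qed.

(** Let [v p] be the coordinate of the image of the generator of [S] at [p]. By naturality [v] is
    constant on the intersection, whose points are comparable. If the constant is nonzero,
    naturality also forces every point of [J] above the intersection into [S] and every point of [S]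
    below it into [J]. *)
Lemma interval_morP S J (g : pmor (interval_mod K S) (interval_mod K J)) :
  exists c : K,
    (forall p x, imod_coord (g p x) = if `[< convex_val J p >] then c * imod_coord x else 0) /\
    (c != 0 -> set_le J S /\ (J : set T) `&` S !=set0).
Proof.
pose u p := imod_scalar `[< convex_val S p >] (1 : K) : interval_mod K S p.
have uE p : convex_val S p -> imod_coord (u p) = 1 by exact: imod_scalarT.
pose v p := imod_coord (g p (u p)).
have gu p x : imod_coord (g p x) = imod_coord x * v p.
  rewrite (_ : x = imod_coord x *: u p) ?linearZ ?imod_coordZ; last first.
    apply: imod_coord_inj; rewrite imod_coordZ.
    have [Sp|nSp] := pselect (convex_val S p); first by rewrite uE// mulr1.
    by rewrite !imod_coord_out0// mul0r.
  have [Sp|nSp] := pselect (convex_val S p); first by rewrite uE// mulr1.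
  by rewrite imod_scalarF// mulr0 imod_coord_out0.
have umap p q (h : (p <= q)%O) : convex_val S p -> convex_val S q ->
    pm_map (interval_mod K S) h (u p) = u q.
  move=> Sp Sq; apply: imod_coord_inj; by rewrite /= imod_coord_mapT// !uE.
have vmap p q : (p <= q)%O -> convex_val S p -> convex_val J q ->
    (convex_val S q -> v p = v q) /\ (v p != 0 -> convex_val S q).
  move=> h Sp Jq; have := pm_natural g h (u p) => /(congr1 (@imod_coord _ _)).
  rewrite /= imod_coord_mapT// -/(v p) => e; split=> [Sq|vp0].
    by rewrite -e -[imod_map _ _ _ _]/(pm_map (interval_mod K S) h (u p)) umap.
  apply: contrapT => nSq; move: vp0; rewrite -e gu imod_coord_mapF//.
  by rewrite mul0r eqxx.
have vJ p : v p != 0 -> convex_val J p by move=> /imod_coord_out.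
have [[p [Sp Jp]]|no] := pselect (exists p, convex_val S p /\ convex_val J p).
  exists (v p); split.
    move=> q x; rewrite gu mulrC; case: (asboolP (convex_val J q)) => Jq; last first.
      by rewrite [v q](_ : _ = 0) ?mul0r//; apply/eqP/negPn/negP => /vJ.
    have [->|x0] := eqVneq (imod_coord x) 0; first by rewrite !mulr0.
    have Sq := imod_coord_out x0.
    by case: (leP p q) => [pq|/ltW qp];
      [have [->]//:= vmap _ _ pq Sp Jq|have [<-]//:= vmap _ _ qp Sq Jp].
  move=> v0; split; last by exists p.
  split=> [q Jq|q Sq].
    case: (leP q p) => [qp|/ltW pq]; first by exists p.
    by exists q => //; have [_] := vmap _ _ pq Sp Jq; exact.
  case: (leP p q) => [pq|/ltW qp]; first by exists p.
  by exists q => //; apply: vJ; have [->]//:= vmap _ _ qp Sq Jp.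
(* Disjoint intervals: the map is zero, and the coefficient 0 makes the second claim vacuous. *)
exists 0; split; last by rewrite eqxx.
move=> p x; rewrite mul0r if_same; apply/eqP/negPn/negP => e.
have Jp := imod_coord_out e; move: e; rewrite gu mulf_eq0 negb_or => /andP[e _].
by apply: no; exists p; split=> //; have := imod_coord_out e.
Qed.

End IntervalMorphisms.

(** * Elimination of summands *)

Section ChangeOfBasis.
Variables (K : fieldType) (d : Order.disp_t) (T : porderType d).
Variables (A X : Type) (J : A -> convexset T) (e : X -> A).
Variables (r : A -> K) (s : A -> X).
Hypothesis e_inj : injective e.
Hypothesis r_fin : finite_set [set a | r a != 0].
Hypothesis r_ok : forall a, r a != 0 -> hom_ok (J (e (s a))) (J a).

Local Notation sumJ := (pm_dsum (fun a => interval_mod K (J a))).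
Local Notation Y := {a : A | ~ exists j, e j = a}.
Local Notation sumY := (pm_dsum (fun a : Y => interval_mod K (J (sval a)))).
Local Notation sumX := (pm_dsum (fun j => interval_mod K (J (e j)))).

Lemma oppr_ok a : - r a != 0 -> hom_ok (J (e (s a))) (J a).
Proof. by rewrite oppr_eq0; exact: r_ok. Qed.

(** The range of [e] is the set of summands to split off. For [a] outside it, [e (s a)] is the
    selected summand used to clear the coefficient at [a], and [r a] is the multiple subtracted. *)
Definition elim_comp (a : Y) : pmor sumJ (interval_mod K (J (sval a))) :=
  pm_add (pm_proj _ (sval a))
    (pm_comp (imor (@oppr_ok (sval a))) (pm_proj _ (e (s (sval a))))).

Lemma elim_compE a p x : imod_coord (elim_comp a p x) =
  sum_coord x (sval a) -
    if `[< convex_val (J (sval a)) p >] then r (sval a) * sum_coord x (e (s (sval a)))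
    else 0.
Proof.
rewrite [LHS](imod_coordD (pm_proj _ _ p x)); congr (_ + _).
by rewrite (imorE (@oppr_ok _)) mulNr; case: ifP => _; rewrite ?oppr0.
Qed.

(** One selected coordinate may feed many unselected ones; the finite support of [r] keeps the image
    inside the direct sum. *)
Lemma elim_comp_fin p x : finite_set [set a | elim_comp a p x != 0].
Proof.
apply: (@sub_finite_set _ _
    (sval @^-1` ([set a | sum_coord x a != 0] `|` [set a | r a != 0]))).
  move=> a /= ga; case: (eqVneq (r (sval a)) 0) => [ra|]; [left|by right].
  apply: contra_neq ga => xa; apply: imod_coord_inj.
  by rewrite elim_compE xa ra mul0r if_same subrr imod_coord0.
apply: finite_preimage; first by move=> a b _ _; exact: sval_inj.
by rewrite finite_setU; split=> //; exact: sum_coord_fin.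
Qed.

Lemma select_comp_fin p (x : sumJ p) : finite_set [set j | pm_proj _ (e j) p x != 0].
Proof.
apply: (@sub_finite_set _ _ (e @^-1` [set a | sum_coord x a != 0])).
  move=> j /=; apply: contra_neq => xj; apply: imod_coord_inj.
  by rewrite imod_coord0.
apply: finite_preimage; first by move=> a b _ _; exact: e_inj.
exact: sum_coord_fin.
Qed.

Definition change_basis : pmor sumJ (pm_sum sumY sumX) :=
  pm_pair (pm_dsum_lift elim_comp_fin)
    (@pm_dsum_lift _ _ _ _ sumJ _ (fun j => pm_proj _ (e j)) select_comp_fin).

Lemma change_basis1 p x (a : Y) :
  sum_coord (pm_comp (pm_fst _ _) change_basis p x) a = sum_coord x (sval a) -
    if `[< convex_val (J (sval a)) p >] then r (sval a) * sum_coord x (e (s (sval a)))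
    else 0.
Proof. exact: elim_compE. Qed.

Lemma change_basis2 p x j :
  sum_coord (pm_comp (pm_snd _ _) change_basis p x) j = sum_coord x (e j).
Proof. by []. Qed.

(** The map is unitriangular: selected coordinates are kept, and every other one changes by a
    multiple of a selected one. *)
Lemma change_basis_iso : pm_is_iso change_basis.
Proof.
apply: pm_bij_is_iso => p.
  move=> x y xy; apply: sum_coord_inj.
  have xe j : sum_coord x (e j) = sum_coord y (e j).
    exact: (congr1 (fun z => sum_coord (pm_snd _ _ p z) j) xy).
  move=> a; have [[j <-]//|na] := pselect (exists j, e j = a).
  have := congr1 (fun z => sum_coord (pm_fst _ _ p z) (exist _ a na)) xy.
  by rewrite [LHS](change_basis1 x) [RHS](change_basis1 y) /= xe; move/addIr.
move=> [y z].
(* Coordinates of the preimage: selected ones are read from [z], the others from [y] with the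
   subtracted multiple added back. *)
pose g a := match pselect (exists j, e j = a) with
  | left h => sum_coord z (projT1 (cid h))
  | right h => sum_coord y (exist _ a h) +
     (if `[< convex_val (J a) p >] then r a * sum_coord z (s a) else 0)
  end.
have ge j : g (e j) = sum_coord z j.
  rewrite /g; case: pselect => [h|[]]; last by exists j.
  by congr sum_coord; apply: e_inj; exact: projT2 (cid h).
have gY (a : Y) : g (sval a) = sum_coord y a +
     (if `[< convex_val (J (sval a)) p >] then r (sval a) * sum_coord z (s (sval a)) else 0).
  rewrite /g; case: pselect => [h|h]; first by case: (svalP a).
  by congr (sum_coord y _ + _); apply: sval_inj.
have [||x xE] := @sum_coord_ex K _ _ A J p g.
- apply: (@sub_finite_set _ _ ((e @` [set j | sum_coord z j != 0]) `|`
    (sval @` [set a | sum_coord y a != 0]) `|` [set a | r a != 0])).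
    move=> a ga; have [[j ja]|na] := pselect (exists j, e j = a).
      by left; left; exists j => //=; rewrite -ge ja.
    case: (eqVneq (r a) 0) => [ra|]; last by right.
    left; right; exists (exist _ a na) => //=; apply: contra_neq ga => ya.
    by rewrite [LHS](gY (exist _ a na)) ya ra mul0r if_same addr0.
  by rewrite !finite_setU; do !split=> //; apply: finite_image; exact: sum_coord_fin.
- move=> a; have [[j <-]|na] := pselect (exists j, e j = a).
    by rewrite ge; exact: sum_coord_out.
  case: (pselect (convex_val (J a) p)) => // nJ.
  have := gY (exist _ a na); rewrite /= asboolF// addr0 => -> h.
  exact: sum_coord_out h.
exists x; congr pair; apply: sum_coord_inj.
  by move=> a; rewrite [LHS]change_basis1 !xE gY ge addrK.
by move=> j; rewrite [LHS]change_basis2 xE ge.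
Qed.

End ChangeOfBasis.

(** * Kernel and cokernel *)

Section SplitMorphism.
Variables (K : fieldType) (d : Order.disp_t) (T : orderType d).
Variables (I : pinterval T) (M N : pmod K T) (f : pmor (interval_mod K I) M).
Variables (X : Type) (Mj : X -> pinterval T) (c : X -> K).
Variable theta : pmor M (pm_sum N (pm_dsum (fun j => interval_mod K (Mj j)))).

Hypothesis theta_iso : pm_is_iso theta.
Hypothesis theta_f1 : forall p x, pm_comp (pm_fst _ _) (pm_comp theta f) p x = 0.
Hypothesis theta_f2 : forall p x j,
  sum_coord (pm_comp (pm_snd _ _) (pm_comp theta f) p x) j =
  if `[< convex_val (Mj j) p >] then c j * imod_coord x else 0.
Hypothesis c_neq0 : forall j, c j != 0.
Hypothesis Mj_le : forall j, set_le (Mj j) I.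

(** Hence each [Mj j] meets [I] in an initial segment of [I]. *)
Lemma Mj_down j p q : convex_val I p -> convex_val (Mj j) q -> (p <= q)%O ->
  convex_val (Mj j) p.
Proof.
move=> Ip Mq pq; have [m Mm mp] := (Mj_le j).2 p Ip.
exact: convexP Mm Mq mp pq.
Qed.

(** Hence the part of [Mj j] outside [I] lies below all of [I]. *)
Lemma Mj_up j p q : convex_val I p -> convex_val (Mj j) q -> (p <= q)%O ->
  convex_val I q.
Proof.
move=> Ip Mq pq; have [m Im qm] := (Mj_le j).1 q Mq.
exact: convexP Ip Im pq qm.
Qed.

Lemma f_eq0 p x : f p x = 0 <-> forall j, convex_val (Mj j) p -> imod_coord x = 0.
Proof.
have [theta' thetaK] := theta_iso; split=> [fx j Mp|x0].
  have := theta_f2 x j; rewrite /= fx linear0 sum_coord0 asboolT// => /esym/eqP.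
  by rewrite mulf_eq0 (negPf (c_neq0 j)) => /eqP.
apply: (can_inj (thetaK p).1); rewrite linear0.
rewrite [theta p _]surjective_pairing; congr pair; first exact: theta_f1.
apply: sum_coord_inj => j; rewrite sum_coord0 [LHS]theta_f2.
by case: asboolP => // Mp; rewrite (x0 j)// mulr0.
Qed.

Section Kernel.
Variable j0 : X.
Hypothesis j0_max : forall j, (Mj j : set T) `&` I `<=` (Mj j0 : set T) `&` I.

Fact ker_set_convex : Defs.convex_set ((I : set T) `\` Mj j0).
Proof.
move=> p q r [Ip nMp] [Ir _] pq qr; split; first exact: convexP Ip Ir pq qr.
by move=> Mq; apply: nMp; exact: Mj_down Ip Mq pq.
Qed.

Definition ker_set := ConvexSet ker_set_convex.

Lemma ker_set_ok : (1 : K) != 0 -> hom_ok ker_set I.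
Proof.
move=> _ p q [Ip nMp] Iq pq; split=> // _; split=> // Mq.
by apply: nMp; exact: Mj_down Ip Mq pq.
Qed.

Local Notation incl := (imor ker_set_ok).

Lemma incl_coord p x : imod_coord (incl p x) = imod_coord x.
Proof.
rewrite imorE mul1r; case: asboolP => // nI; apply/esym/imod_coord_out0.
by move=> -[].
Qed.

Lemma incl_ker p x : incl p x \in lker_pred (f p).
Proof.
rewrite unfold_in; apply/eqP/f_eq0 => j Mp; rewrite incl_coord.
by apply: imod_coord_out0 => -[Ip]; apply; have [] := j0_max (conj Mp Ip).
Qed.

Definition ker_app p (x : interval_mod K ker_set p) : pm_ker f p := LKer (incl_ker x).

Fact ker_app_linear p : linear (@ker_app p).
Proof. by move=> k x y; apply: val_inj; rewrite /= linearP. Qed.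

HB.instance Definition _ p := GRing.isLinear.Build K
  (interval_mod K ker_set p) (pm_ker f p) *:%R (@ker_app p) (@ker_app_linear p).

Program Definition ker_mor : pmor (interval_mod K ker_set) (pm_ker f) :=
  @PMor _ _ _ (interval_mod K ker_set) (pm_ker f) (fun p => @ker_app p) _.
Next Obligation. by move=> p q h x; apply: val_inj; exact: (pm_natural incl). Qed.

(** By [f_eq0] the kernel lives at the points of [I] that avoid every [Mj j]; by [j0_max] these are
    the points that avoid [Mj j0]. *)
Lemma pm_ker_eqP : pm_ker_eq f ker_set.
Proof.
exists ker_mor; split.
  apply: pm_bij_is_iso => p.
    move=> x y /(congr1 val) /= /(congr1 (@imod_coord _ _)).
    by rewrite !incl_coord => /imod_coord_inj.
  move=> y; exists (imod_map K `[< convex_val I p >] `[< convex_val ker_set p >] (val y)).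
  apply: val_inj; apply: imod_coord_inj; rewrite [LHS]incl_coord.
  have /eqP/f_eq0 fy := valP y.
  have [kp|nkp] := pselect (convex_val ker_set p); first by rewrite imod_coord_mapT.
  rewrite imod_coord_mapF//; apply/esym.
  have [Ip|nIp] := pselect (convex_val I p); last exact: imod_coord_out0.
  by apply: (fy j0); apply: contrapT => nM; exact: nkp.
move=> p x; apply: imod_coord_inj; rewrite [LHS]incl_coord.
have [Ip|nIp] := pselect (convex_val I p); first by rewrite imod_coord_mapT.
by rewrite imod_coord_mapF// imod_coord_out0// => -[].
Qed.

End Kernel.

End SplitMorphism.

Section Cokernel.
Variables (K : fieldType) (d : Order.disp_t) (T : orderType d).
Variables (I : pinterval T) (n : nat) (Mj : 'I_n.+1 -> pinterval T) (c : 'I_n.+1 -> K).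
Hypothesis c_neq0 : forall j, c j != 0.
Hypothesis Mj_le : forall j, set_le (Mj j) I.
Hypothesis Mj_meet : forall j, (Mj j : set T) `&` I !=set0.

Let w (j : 'I_n) : 'I_n.+1 := widen_ord (leqnSn n) j.
Let l (j : 'I_n) : 'I_n.+1 := lift ord0 j.
Hypothesis Mj_sub : forall j, (Mj (l j) : set T) `<=` Mj (w j).

Local Notation sumM := (pm_dsum (fun j => interval_mod K (Mj j))).
Local Notation down := (Mj_down Mj_le).
Local Notation up := (Mj_up Mj_le).

Fact top_set_convex : Defs.convex_set ((Mj ord_max : set T) `\` I).
Proof.
move=> p q r [Mp nIp] [Mr nIr] pq qr; split; first exact: convexP Mp Mr pq qr.
by move=> Iq; apply: nIr; exact: up Iq Mr qr.
Qed.

Definition top_set := ConvexSet top_set_convex.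

(** On [I] the set is the smaller summand, off [I] it is the whole larger one; all later arguments
    use this form. *)
Lemma step_memP j p :
  ((Mj (w j) : set T) `\` (((Mj (w j) : set T) `\` Mj (l j)) `&` I)) p <->
  convex_val (Mj (w j)) p /\ (convex_val I p -> convex_val (Mj (l j)) p).
Proof.
split=> -[Mp h]; split=> //; last by move=> [[_ nMp] /h].
by move=> Ip; apply: contrapT => nMp; apply: h.
Qed.

Fact step_set_convex j : Defs.convex_set
  ((Mj (w j) : set T) `\` (((Mj (w j) : set T) `\` Mj (l j)) `&` I)).
Proof.
move=> p q r /step_memP[Mp _] /step_memP[Mr hr] pq qr; apply/step_memP.
split; first exact: convexP Mp Mr pq qr.
by move=> Iq; apply: (down Iq _ qr); apply: hr; exact: up Iq Mr qr.
Qed.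

Definition step_set j := ConvexSet (@step_set_convex j).

Lemma top_ok : (c ord_max)^-1 != 0 -> hom_ok (Mj ord_max) top_set.
Proof.
move=> _ p q Mp [Mq nIq] pq; split=> // _; split=> // Ip.
by apply: nIq; exact: up Ip Mq pq.
Qed.

Lemma step_ok1 j : (c (w j))^-1 != 0 -> hom_ok (Mj (w j)) (step_set j).
Proof.
move=> _ p q Mp /step_memP[Mq hq] pq; split=> // _; apply/step_memP; split=> // Ip.
by apply: (down Ip _ pq); apply: hq; exact: up Ip Mq pq.
Qed.

Lemma step_ok2 j : - (c (l j))^-1 != 0 -> hom_ok (Mj (l j)) (step_set j).
Proof.
move=> _ p q Mp /step_memP[Mq hq] pq; split=> _; last first.
  by apply/step_memP; split=> //; exact: Mj_sub.
(* Either [q] lies between two points of the smaller summand, or it lies above a point of [I], hence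
   in [I], where the step set is contained in that summand. *)
have [z [Mz Iz]] := Mj_meet (l j); case: (leP q z) => [qz|/ltW zq].
  exact: convexP Mp Mz pq qz.
by apply: hq; exact: up Iz Mq zq.
Qed.

Local Notation sumE := (pm_dsum (fun j => interval_mod K (step_set j))).

Definition top_comp : pmor sumM (interval_mod K top_set) :=
  pm_comp (imor top_ok) (pm_proj _ ord_max).

Definition step_comp j : pmor sumM (interval_mod K (step_set j)) :=
  pm_add (pm_comp (imor (@step_ok1 j)) (pm_proj _ (w j)))
         (pm_comp (imor (@step_ok2 j)) (pm_proj _ (l j))).

Lemma step_comp_fin p x : finite_set [set j | step_comp j p x != 0].
Proof. exact: finite_finset. Qed.

Definition coker_mor : pmor sumM (pm_sum (interval_mod K top_set) sumE) :=
  pm_pair top_comp (pm_dsum_lift step_comp_fin).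

(** Normalised coordinates: on a multiple of [c] they agree at all summands containing [p]. Indexing
    by naturals through [inord] permits induction on [m]. *)
Let W p (z : sumM p) (m : nat) : K := sum_coord z (inord m) / c (inord m).
Let Mn m : set T := Mj (inord m).

Let wE j : w j = inord j.
Proof. by apply: val_inj; rewrite /= inordK// ltnS ltnW. Qed.

Let lE j : l j = inord j.+1.
Proof. by apply: val_inj; rewrite /= inordK// ltnS. Qed.

Let maxE : ord_max = inord n :> 'I_n.+1.
Proof. by apply: val_inj; rewrite /= inordK. Qed.

Lemma top_compE p z :
  imod_coord (top_comp p z) = if `[< convex_val top_set p >] then W z n else 0.
Proof.
by rewrite (imorE top_ok) /W -maxE mulrC.
Qed.

Lemma step_compE j p z : imod_coord (step_comp j p z) =
  if `[< convex_val (step_set j) p >] then W z j - W z j.+1 else 0.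
Proof.
rewrite [LHS]imod_coordD (imorE (@step_ok1 j)) (imorE (@step_ok2 j)).
rewrite /W -wE -lE mulNr -!(mulrC _^-1).
by case: ifP => _; rewrite ?addr0.
Qed.

Let Mn_sub i m : (i <= m <= n)%N -> Mn m `<=` Mn i.
Proof.
elim: m => [|m IH] /andP[im mn]; first by move: im; rewrite leqn0 => /eqP->.
move: im; rewrite leq_eqVlt => /predU1P[->//|]; rewrite ltnS => im.
apply: (subset_trans _ (IH _)); last by rewrite im ltnW.
by have := @Mj_sub (Ordinal mn); rewrite wE lE.
Qed.

Let W0 p (z : sumM p) m : ~ Mn m p -> W z m = 0.
Proof. by move=> nM; rewrite /W sum_coord_out0 ?mul0r. Qed.

(** If [p] is in [I], vanishing makes [W z] constant on the indices of summands containing [p], and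
    this constant is [x]. If [p] is outside [I], the top component also gives [W z n = 0], so all
    coordinates vanish. *)
Lemma coker_mor_eq0 p (z : sumM p) : coker_mor p z = 0 <->
  exists x : interval_mod K I p,
    forall j, sum_coord z j = if `[< convex_val (Mj j) p >] then c j * imod_coord x else 0.
Proof.
split=> [z0|[x zx]]; last first.
  have zW m : W z m = if `[< Mn m p >] then imod_coord x else 0.
    rewrite /W zx /Mn; case: asboolP => _; last by rewrite mul0r.
    by rewrite mulrAC mulfV// mul1r.
  have x0 : ~ convex_val I p -> imod_coord x = 0 by exact: imod_coord_out0.
  rewrite [LHS]surjective_pairing; congr pair.
    apply: imod_coord_inj; rewrite imod_coord0 [LHS]top_compE.
    by case: asboolP => // -[_ nIp]; rewrite zW x0// if_same.
  apply: sum_coord_inj => j; rewrite sum_coord0 [LHS]step_compE.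
  case: asboolP => // /step_memP[Mp hp]; rewrite !zW.
  have [Ip|nIp] := pselect (convex_val I p); last by rewrite x0// !if_same subrr.
  have Mj' : Mn j p by rewrite /Mn -wE.
  have Mj'' : Mn j.+1 p by rewrite /Mn -lE; exact: hp.
  by rewrite (asboolT Mj') (asboolT Mj'') subrr.
have Wtop : Mn n p -> ~ convex_val I p -> W z n = 0.
  move=> Mp nIp; have tp : convex_val top_set p by split=> //; rewrite maxE.
  have := top_compE z; have -> : imod_coord (top_comp p z) = 0.
    by rewrite (congr1 fst z0 : top_comp p z = 0) imod_coord0.
  by rewrite asboolT.
have Wstep m : (m < n)%N -> Mn m p -> (convex_val I p -> Mn m.+1 p) -> W z m = W z m.+1.
  move=> mn Mp hp; pose j := Ordinal mn.
  have sp : convex_val (step_set j) p by apply/step_memP; rewrite wE lE.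
  have := step_compE j z; have -> : imod_coord (step_comp j p z) = 0.
    have -> : step_comp j p z = 0.
      exact: (congr1 (fun y => pm_proj _ j p (pm_snd _ _ p y)) z0).
    exact: imod_coord0.
  by rewrite asboolT// => /esym/eqP; rewrite subr_eq0 => /eqP.
have zW j : sum_coord z j = c j * W z j by rewrite /W inord_val mulrC divfK.
have zout j : ~ convex_val (Mj j) p -> sum_coord z j = 0 by move=> nM; rewrite sum_coord_out0.
have [Ip|nIp] := pselect (convex_val I p).
  (* The summands containing [p] form an initial segment of indices, so induction upwards from 0
     compares each [W z j] with [W z 0]. *)
  exists (imod_scalar _ (W z 0)) => j; rewrite imod_scalarT//.
  case: asboolP => [Mp|/zout//]; rewrite zW; congr (_ * _).
  have : (j <= n)%N by rewrite -ltnS.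
  have : Mn j p by rewrite /Mn inord_val.
  elim: (j : nat) => // m IH Mm mn.
  have Mm' : Mn m p by apply: (Mn_sub _ Mm); rewrite leqnSn.
  by rewrite -Wstep// IH// ltnW.
exists 0 => j; rewrite imod_coord0 mulr0 if_same zW.
(* Downward induction on [m], starting from [n], with [k] as the distance to [n]. *)
suff : forall k m, (m + k = n)%N -> W z m = 0.
  by move=> /(_ (n - j)%N j); rewrite subnKC -1?ltnS// => -> //; rewrite mulr0.
elim=> [|k IH] m; first rewrite addn0 => ->.
  by have [Mp|/W0//] := pselect (Mn n p); exact: Wtop.
move=> mk; have [Mp|/W0//] := pselect (Mn m p).
by rewrite Wstep// ?IH// -?mk; lia.
Qed.

Lemma coker_mor_surj p y : exists z, coker_mor p z = y.
Proof.
case: y => [t ee].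
(* The telescoping solution of [V n = t] and [V j - V j.+1 = ee j]. Its terms are supported inside
   [Mn m], so [V m] vanishes wherever the summand does. *)
pose V m := imod_coord t + \sum_(i < n | (m <= i)%N) sum_coord ee i.
have VM m : (m <= n)%N -> V m != 0 -> Mn m p.
  move=> mn /eqP V0; apply: contrapT => nM; apply: V0.
  rewrite /V imod_coord_out0 ?add0r; last first.
    by move=> [Mp _]; apply: nM; apply: (@Mn_sub m n); [rewrite mn/=|rewrite /Mn -maxE].
  apply: big1 => i mi; apply: sum_coord_out0 => /step_memP[Mp _]; apply: nM.
  by apply: (@Mn_sub m i); [rewrite mi/= ltnW|rewrite /Mn -wE].
have [||z zE] := @sum_coord_ex K _ _ _ (fun j => Mj j) p (fun j => c j * V j).
- exact: finite_finset.
- move=> j; rewrite mulf_eq0 negb_or => /andP[_ /VM]; rewrite /Mn inord_val; apply.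
  by rewrite -ltnS.
have WV m : (m <= n)%N -> W z m = V m.
  by move=> mn; rewrite /W zE inordK// mulrAC mulfV// mul1r.
exists z; congr pair.
  apply: imod_coord_inj; rewrite [LHS]top_compE WV//; set v := RHS.
  case: asboolP => [_|nt]; last by rewrite /v imod_coord_out0.
  by rewrite /V big1 ?addr0// => i; rewrite leqNgt ltn_ord.
apply: sum_coord_inj => j; rewrite [LHS]step_compE; set v := RHS.
case: asboolP => [_|ns]; last by rewrite /v sum_coord_out0.
rewrite /v !WV//; last exact: ltnW.
rewrite /V opprD addrACA subrr add0r (bigD1 j)//=.
rewrite (eq_bigl (fun i : 'I_n => (j < i)%N)) ?addrK//.
by move=> i; rewrite ltn_neqAle andbC eq_sym.
Qed.

End Cokernel.

Section CokernelIso.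
Variables (K : fieldType) (d : Order.disp_t) (T : orderType d).
Variables (I : pinterval T) (M N : pmod K T) (f : pmor (interval_mod K I) M).
Variables (n : nat) (Mj : 'I_n.+1 -> pinterval T) (c : 'I_n.+1 -> K).
Variable theta : pmor M (pm_sum N (pm_dsum (fun j => interval_mod K (Mj j)))).

Hypothesis theta_iso : pm_is_iso theta.
Hypothesis theta_f1 : forall p x, pm_comp (pm_fst _ _) (pm_comp theta f) p x = 0.
Hypothesis theta_f2 : forall p x j,
  sum_coord (pm_comp (pm_snd _ _) (pm_comp theta f) p x) j =
  if `[< convex_val (Mj j) p >] then c j * imod_coord x else 0.
Hypothesis c_neq0 : forall j, c j != 0.
Hypothesis Mj_le : forall j, set_le (Mj j) I.
Hypothesis Mj_meet : forall j, (Mj j : set T) `&` I !=set0.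
Hypothesis Mj_sub : forall j : 'I_n,
  (Mj (lift ord0 j) : set T) `<=` Mj (widen_ord (leqnSn n) j).

Lemma pm_coker_isoP : pm_iso (pm_coker f)
  (pm_sum N (pm_sum (interval_mod K (top_set Mj_le))
    (pm_dsum (fun j => interval_mod K (step_set Mj_le j))))).
Proof.
have [theta' thetaK] := theta_iso.
apply: (@pm_coker_iso _ _ _ _ _ _ f (pm_pair (pm_comp (pm_fst _ _) theta)
  (pm_comp (coker_mor c Mj_le Mj_meet Mj_sub) (pm_comp (pm_snd _ _) theta)))) => p.
  move=> [a b]; have [z zb] := coker_mor_surj c_neq0 Mj_meet Mj_sub b.
  exists (theta' p (a, z)); congr pair; rewrite /= (thetaK p).2//.
move=> x; split.
  move=> gx; have x1 : (theta p x).1 = 0 := congr1 fst gx.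
  have /(coker_mor_eq0 c_neq0)[y yx] :
    coker_mor c Mj_le Mj_meet Mj_sub p (theta p x).2 = 0 := congr1 snd gx.
  exists y; apply: (can_inj (thetaK p).1).
  rewrite [LHS]surjective_pairing [RHS]surjective_pairing; congr pair.
    by rewrite x1; exact: theta_f1.
  by apply: sum_coord_inj => j; rewrite yx [LHS]theta_f2.
move=> [y <-]; congr pair; first exact: theta_f1.
by apply/(coker_mor_eq0 c_neq0); exists y => j; rewrite [LHS]theta_f2.
Qed.

End CokernelIso.

(** * Choosing and ordering the summands *)

Section Enumeration.
Variables (X : choiceType) (r : rel X).
Hypothesis r_trans : transitive r.

(** Insertion: a new element below a member of [t] is dropped; otherwise it replaces the members
    below it. Of several equivalent elements at most one survives. *)
Lemma maximal_antichain (s : seq X) : reflexive r ->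
  exists t : seq X, [/\ uniq t, {subset t <= s},
    {in t &, forall x y, r x y -> x = y} &
    {in s, forall x, exists2 y, y \in t & r x y}].
Proof.
move=> r_refl; elim: s => [|a s [t [ut ts tr st]]]; first by exists [::].
have [/hasP[b bt ab]|/hasPn nab] := boolP (has (r a) t).
  exists t; split=> //; first by move=> x /ts; rewrite inE orbC => ->.
  by move=> x /predU1P[->|/st//]; exists b.
exists (a :: [seq x <- t | ~~ r x a]); split.
- rewrite /= filter_uniq// andbT mem_filter negb_and negbK; apply/orP; left.
  exact: r_refl.
- move=> x; rewrite !inE mem_filter => /orP[->//|/andP[_ /ts->]].
  by rewrite orbT.
- move=> x y; rewrite !inE !mem_filter.
  move=> /orP[/eqP->|/andP[/negPf xa xt]] /orP[/eqP->|/andP[ya yt]] //.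
  + by rewrite (negPf (nab y yt)).
  + by rewrite xa.
  + exact: tr.
- move=> x /predU1P[->|/st[y yt xy]]; first by exists a; rewrite ?mem_head.
  have [ya|nya] := boolP (r y a).
    by exists a; rewrite ?mem_head// (r_trans xy).
  by exists y => //; rewrite inE mem_filter nya yt orbT.
Qed.

Hypothesis r_total : total r.
Hypothesis r_fin : forall b, finite_set [set x | r x b].

(** Pick any [b] outside [l] and sort its finitely many predecessors outside [l]. The head is below
    all of these, and below everything else through [b], by totality. *)
Lemma least_outside (l : seq X) : infinite_set [set: X] ->
  exists m, m \notin l /\ forall x, x \notin l -> r m x.
Proof.
move=> Xinf; have [b bl] : exists b, b \notin l.
  apply: contrapT => nb; apply: Xinf; apply/finite_seqP; exists l.
  apply/seteqP; split=> // x _ /=; apply: contrapT => /negP xl; apply: nb.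
  by exists x.
have /finite_seqP[s sE] : finite_set [set x | r x b /\ x \notin l].
  by apply: sub_finite_set (r_fin b) => x [].
have mem_s x : (x \in s) <-> r x b /\ x \notin l.
  by rewrite -[_ /\ _]/([set x | r x b /\ x \notin l] x) sE.
have bb : r b b by have /orP[] := r_total b b.
have : b \in sort r s by rewrite mem_sort; apply/mem_s.
case E : (sort r s) => [//|h t] _.
have hs : h \in s by rewrite -(mem_sort r) E mem_head.
have [hb hl] := (mem_s h).1 hs.
have rt : all (r h) t.
  by apply: order_path_min => //; have := sort_sorted r_total s; rewrite E.
exists h; split=> // x xl; have [xb|] := boolP (r x b).
  have : x \in sort r s by rewrite mem_sort; apply/mem_s.
  rewrite E => /predU1P[->|/(allP rt)//].
  by have /orP[] := r_total h h.
by move=> nxb; apply: r_trans hb _; have := r_total x b; rewrite (negPf nxb).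
Qed.

(** Repeatedly take a least element not yet listed. An element never reached would have every [e n]
    among its finitely many predecessors. *)
Lemma enumeration : infinite_set [set: X] ->
  exists e : nat -> X, [/\ injective e, forall x, exists n, e n = x &
    forall n, r (e n) (e n.+1)].
Proof.
move=> Xinf; pose F l := projT1 (cid (least_outside l Xinf)).
have F1 l : F l \notin l := (projT2 (cid (least_outside l Xinf))).1.
have F2 l x : x \notin l -> r (F l) x := (projT2 (cid (least_outside l Xinf))).2 x.
pose q n := iter n (fun l => F l :: l) [::].
pose e n := F (q n).
have qE n : q n.+1 = e n :: q n by [].
have mem_q i j : (i < j)%N -> e i \in q j.
  elim: j => // j IH; rewrite ltnS leq_eqVlt qE inE => /predU1P[->|/IH->].
    by rewrite eqxx.
  by rewrite orbT.
have ninj i j : (i < j)%N -> e i <> e j.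
  by move=> /mem_q + eij; rewrite eij => h; have := F1 (q j); rewrite h.
have e_inj : injective e.
  by move=> i j eij; have [/ninj/(_ eij)[]|/ninj/(_ (esym eij))[]|//] := ltngtP i j.
exists e; split=> // [x|n]; last first.
  by apply: F2; have := F1 (q n.+1); rewrite qE inE negb_or => /andP[].
apply: contrapT => nx.
have xq n : x \notin q n.
  elim: n => // n IH; rewrite qE inE negb_or IH andbT.
  by apply/eqP => xe; apply: nx; exists n.
apply: infinite_nat; have := r_fin x.
move/(finite_preimage (f := e)) => /(_ (in2W e_inj)).
by apply: sub_finite_set => n _; exact: F2.
Qed.

End Enumeration.

(** * Coefficients of a map out of an interval module *)

Section Splitting.
Variables (K : fieldType) (d : Order.disp_t) (T : orderType d).
Variables (I : pinterval T) (M : pmod K T) (f : pmor (interval_mod K I) M).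

Section NoInfiniteSplitting.
Variables (N : pmod K T) (Mj : nat -> pinterval T).
Variable theta : pmor M (pm_sum N (pm_dsum (fun j => interval_mod K (Mj j)))).

(** Each [Mj j] meets [I] in an initial segment and so contains the least point [p]. The generator
    of [I] at [p] would then have infinitely many nonzero coordinates in a direct sum. *)
Lemma least_no_infinite_splitting p : convex_val I p ->
  (forall q, convex_val I q -> (p <= q)%O) -> ~ splitting id f theta.
Proof.
move=> Ip pmin [_ _ _ Mj_ok _].
pose x := imod_scalar `[< convex_val I p >] (1 : K) : interval_mod K I p.
apply: infinite_nat.
apply: sub_finite_set (sum_coord_fin (pm_comp (pm_snd _ _) (pm_comp theta f) p x)) => j _.
have [Mle _ nz] := Mj_ok j.
have [c [cE cle]] :=
  interval_morP (pm_comp (pm_comp (pm_proj _ j) (pm_snd _ _)) (pm_comp theta f)).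
have c0 : c != 0.
  apply: contraPneq nz => c0 -[q [y]]; apply/negP; rewrite negbK; apply/eqP.
  by apply: imod_coord_inj; rewrite cE c0 mul0r if_same imod_coord0.
have Mp : convex_val (Mj j) p.
  have [q [Mq Iq]] := (cle c0).2.
  have [m Mm mp] := Mle.2 p Ip.
  exact: convexP Mm Mq mp (pmin q Iq).
by rewrite /= -[sum_coord _ _]/(imod_coord (pm_comp (pm_comp (pm_proj _ j) (pm_snd _ _))
  (pm_comp theta f) p x)) cE (asboolT Mp) imod_scalarT// mulr1.
Qed.

End NoInfiniteSplitting.

Variables (A : Type) (J : A -> pinterval T).
Variable phi : pmor M (pm_dsum (fun a => interval_mod K (J a))).
Hypothesis phi_iso : pm_is_iso phi.

Lemma interval_sum_morP : exists c : A -> K,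
  (forall p x a, sum_coord (phi p (f p x)) a =
     if `[< convex_val (J a) p >] then c a * imod_coord x else 0) /\
  (forall a, c a != 0 -> set_le (J a) I /\ (J a : set T) `&` I !=set0).
Proof.
pose g a := pm_comp (pm_comp (pm_proj _ a) phi) f.
pose cP a := cid (interval_morP (g a)).
exists (fun a => projT1 (cP a)); split=> [p x a|a].
  exact: (projT2 (cP a)).1.
exact: (projT2 (cP a)).2.
Qed.

Variable c : A -> K.
Hypothesis cE : forall p x a, sum_coord (phi p (f p x)) a =
  if `[< convex_val (J a) p >] then c a * imod_coord x else 0.
Hypothesis c_ok : forall a, c a != 0 -> set_le (J a) I /\ (J a : set T) `&` I !=set0.

(** [N] is the sum of the unselected summands. The last hypothesis says that the subtraction in
    [change_basis] cancels the coefficient of [f] at each of them. *)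
Lemma exists_splitting (X : Type) (e : X -> A) (r : A -> K) (s : A -> X) :
  injective e -> finite_set [set a | r a != 0] ->
  (forall a, r a != 0 -> set_le (J a) (J (e (s a)))) ->
  (forall j, c (e j) != 0) ->
  (forall a, ~ (exists j, e j = a) -> c a = r a * c (e (s a))) ->
  exists (N : pmod K T)
    (theta : pmor M (pm_sum N (pm_dsum (fun j => interval_mod K (J (e j)))))),
  [/\ interval_decomposable N, pm_is_iso theta,
      forall p x, pm_comp (pm_fst _ _) (pm_comp theta f) p x = 0 &
      forall p x j, sum_coord (pm_comp (pm_snd _ _) (pm_comp theta f) p x) j =
        if `[< convex_val (J (e j)) p >] then c (e j) * imod_coord x else 0].
Proof.
move=> e_inj r_fin r_le ce cr.
have r_ok a : r a != 0 -> hom_ok (J (e (s a))) (J a).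
  by move=> /r_le/set_le_hom_ok.
pose psi := change_basis e_inj r_fin r_ok.
exists (pm_dsum (fun a : {a | ~ exists j, e j = a} => interval_mod K (J (sval a)))).
exists (pm_comp psi phi); split.
- exists {a | ~ exists j, e j = a}, (fun a => J (sval a)).
  exact: pm_iso_refl.
- exact/pm_comp_iso/phi_iso/change_basis_iso.
- move=> p x; apply: sum_coord_inj => a.
  rewrite [LHS](change_basis1 e_inj r_fin r_ok) sum_coord0 !cE.
  case: asboolP => Jp; last by rewrite subrr.
  have [Ip|nIp] := pselect (convex_val I p); last first.
    by rewrite imod_coord_out0// !mulr0 if_same mulr0 subrr.
  rewrite (cr _ (svalP a)); have [->|r0] := eqVneq (r (sval a)) 0.
    by rewrite !mul0r subrr.
  (* The selected interval contains [p] too: it has a point above [p] because it dominates [J a],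
     and one below because it is below [I]. *)
  rewrite (_ : `[< convex_val (J (e (s (sval a)))) p >] = true) ?mulrA ?subrr//.
  apply: asboolT; have [q Jq pq] := (r_le _ r0).1 p Jp.
  have [q' Jq' qp] := (c_ok (ce (s (sval a)))).1.2 p Ip.
  exact: convexP Jq' Jq qp pq.
- by move=> p x j; rewrite [LHS]cE.
Qed.

Lemma splittingP (X : Type) (rank : X -> nat) (e : X -> A) (N : pmod K T)
    (theta : pmor M (pm_sum N (pm_dsum (fun j => interval_mod K (J (e j)))))) :
  (forall j, c (e j) != 0) ->
  (forall j k, rank k = (rank j).+1 ->
    (J (e k) : set T) `&` I `<=` (J (e j) : set T) `&` I) ->
  [/\ interval_decomposable N, pm_is_iso theta,
      forall p x, pm_comp (pm_fst _ _) (pm_comp theta f) p x = 0 &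
      forall p x j, sum_coord (pm_comp (pm_snd _ _) (pm_comp theta f) p x) j =
        if `[< convex_val (J (e j)) p >] then c (e j) * imod_coord x else 0] ->
  splitting rank f theta.
Proof.
move=> ce nest [Ndec tiso t1 t2]; split=> // j; have [Jle Jmeet] := c_ok (ce j).
split=> //; have [p [Jp Ip]] := Jmeet.
exists p, (imod_scalar `[< convex_val I p >] (1 : K) : interval_mod K I p).
apply: contraTneq (ce j) => e0; rewrite negbK; apply/eqP.
have := t2 p (imod_scalar `[< convex_val I p >] (1 : K)) j.
rewrite (asboolT Jp) imod_scalarT// mulr1 => <-.
by rewrite [LHS](congr1 (@imod_coord _ _) e0) imod_coord0.
Qed.

Lemma nonzero_coef : pm_nonzero f -> exists a, c a != 0.
Proof.
move=> [p [x fx]]; apply: contrapT => nc; have [phi' phiK] := phi_iso.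
move/eqP: fx; apply; apply: (can_inj (phiK p).1); rewrite linear0.
apply: sum_coord_inj => a; rewrite sum_coord0 cE.
case: asboolP => // _; have [->|ca] := eqVneq (c a) 0; first by rewrite mul0r.
by case: nc; exists a.
Qed.

(** The listed [c a] are the nonzero coordinates of the image of the generator of [I] at [p]. *)
Lemma coef_fin p : convex_val I p ->
  finite_set [set a | c a != 0 /\ convex_val (J a) p].
Proof.
move=> Ip; pose x := imod_scalar `[< convex_val I p >] (1 : K) : interval_mod K I p.
apply: sub_finite_set (sum_coord_fin (phi p (f p x))) => a [ca Jp] /=.
by rewrite cE (asboolT Jp) imod_scalarT// mulr1.
Qed.

(** Both traces are initial segments of the chain [I]. *)
Lemma meet_total a b : c a != 0 -> c b != 0 ->
  (J b : set T) `&` I `<=` (J a : set T) `&` I \/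
  (J a : set T) `&` I `<=` (J b : set T) `&` I.
Proof.
move=> ca cb; have [|nba] := pselect ((J b : set T) `&` I `<=` (J a : set T) `&` I).
  by left.
right=> p [Jp Ip]; split=> //; apply: contrapT => nJ; apply: nba => q [Jq Iq].
split=> //; have [[a1 a2] _] := c_ok ca; have [[b1 b2] _] := c_ok cb.
have qp : (q <= p)%O.
  case: (leP q p) => // /ltW pq; case: nJ.
  by have [m Jm mp] := b2 p Ip; exact: convexP Jm Jq mp pq.
by have [m Jm mq] := a2 q Iq; exact: convexP Jm Jp mq qp.
Qed.

(* Both ends of [J b] lie strictly inside [J a]: the upper one because [J b]
   is not above [J a], the lower one because it is not below. *)
Lemma meet_Supset a b : c a != 0 -> c b != 0 ->
  (J b : set T) `&` I `<=` (J a : set T) `&` I ->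
  ~ set_le (J a) (J b) -> ~ set_le (J b) (J a) -> set_Supset (J a) (J b).
Proof.
move=> ca cb ba nab nba.
have [[a1 a2] _] := c_ok ca; have [[b1 b2] [z [Jbz Iz]]] := c_ok cb.
have [Jaz _] := ba z (conj Jbz Iz).
have up q : convex_val (J b) q -> exists2 y, convex_val (J a) y & (q <= y)%O.
  move=> Jq; case: (leP q z) => [qz|/ltW zq]; first by exists z.
  exists q => //; apply: (ba q _).1; split=> //.
  by have [i Ii qi] := b1 q Jq; exact: convexP Iz Ii zq qi.
(* Without such an [l], every point of [J a] would have a point of [J b] below it; together with
   [up] this is [J b] below [J a]. The bound [u] is obtained dually, with [l] in the role of
   [up]. *)
have [l Jl ll] : exists2 l, convex_val (J a) l & forall q, convex_val (J b) q -> (l < q)%O.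
  apply: contrapT => nl; apply: nba; split=> // l Jl; apply: contrapT => nq.
  apply: nl; exists l => // q Jq; rewrite ltNge; apply/negP => ql; apply: nq.
  by exists q.
have [u Ju uu] : exists2 u, convex_val (J a) u & forall q, convex_val (J b) q -> (q < u)%O.
  apply: contrapT => nu; apply: nab; split=> [u Ju|q Jq].
    apply: contrapT => nq; apply: nu; exists u => // q Jq; rewrite ltNge.
    by apply/negP => uq; apply: nq; exists q.
  by exists l => //; exact/ltW/ll.
split; last by exists l, u; split=> // q Jq; split; [exact: ll|exact: uu].
by move=> q Jq; exact: convexP Jl Ju (ltW (ll q Jq)) (ltW (uu q Jq)).
Qed.

End Splitting.

(** * Finitely or infinitely many nonzero coefficients *)

Section Cases.
Variables (K : fieldType) (d : Order.disp_t) (T : orderType d).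
Variables (I : pinterval T) (M : pmod K T) (f : pmor (interval_mod K I) M).
Variables (A : choiceType) (J : A -> pinterval T).
Variable phi : pmor M (pm_dsum (fun a => interval_mod K (J a))).
Hypothesis phi_iso : pm_is_iso phi.
Variable c : A -> K.
Hypothesis cE : forall p x a, sum_coord (phi p (f p x)) a =
  if `[< convex_val (J a) p >] then c a * imod_coord x else 0.
Hypothesis c_ok : forall a, c a != 0 -> set_le (J a) I /\ (J a : set T) `&` I !=set0.

(** Larger traces on [I] come first, so sorting by [r] lists the summands by decreasing trace. *)
Let r (a b : A) := `[< (J b : set T) `&` I `<=` (J a : set T) `&` I >].

Let r_trans : transitive r.
Proof.
move=> b a e /asboolP ba /asboolP eb; apply/asboolP.
exact: subset_trans eb ba.
Qed.

Lemma finite_splitting : pm_nonzero f -> finite_set [set a | c a != 0] ->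
  exists (n : nat) (N : pmod K T) (Mj : 'I_n.+1 -> pinterval T)
       (theta : pmor M (pm_sum N (pm_dsum (fun j => interval_mod K (Mj j))))),
     [/\ splitting (@nat_of_ord n.+1) f theta,
         forall j k : 'I_n.+1, k = j.+1 :> nat -> set_Supset (Mj j) (Mj k),
         ~ has_lower_bound I -> n = 0%N,
         exists2 D : convexset T,
           D = (I : set T) `\` Mj ord0 :> set T & pm_ker_eq f D &
         exists (D : convexset T) (E : 'I_n -> convexset T),
           [/\ D = (Mj ord_max : set T) `\` I :> set T,
               forall j : 'I_n,
                 E j = (Mj (widen_ord (leqnSn n) j) : set T) `\`
                   (((Mj (widen_ord (leqnSn n) j) : set T) `\`
                     Mj (lift ord0 j)) `&` I) :> set T &
               pm_iso (pm_coker f)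
                 (pm_sum N (pm_sum (interval_mod K D)
                   (pm_dsum (fun j => interval_mod K (E j)))))]].
Proof.
move=> fnz /finite_seqP[s sE].
have mem_s a : (a \in s) = (c a != 0).
  have sP : [set a | c a != 0] a <-> [set` s] a by rewrite sE.
  by apply/idP/idP => /sP.
pose le a b := `[< set_le (J a) (J b) >].
have le_refl : reflexive le.
  by move=> a; apply/asboolP; split=> p Jp; exists p.
have le_trans : transitive le.
  move=> b a e /asboolP[ab1 ab2] /asboolP[be1 be2]; apply/asboolP; split.
    by move=> p /ab1[q /be1[u Ju qu] pq]; exists u => //; exact: Order.POrderTheory.le_trans qu.
  by move=> p /be2[q /ab2[u Ju uq] qp]; exists u => //; exact: Order.POrderTheory.le_trans qp.
have [t [ut ts t_anti t_cov]] := maximal_antichain le_trans s le_refl.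
(* [t'] is nonempty because [f] is nonzero, so its entries are indexed by ['I_n.+1]. *)
pose t' := sort r t; pose n := (size t').-1.
have mem_t' a : (a \in t') = (a \in t) by rewrite mem_sort.
have ct a : a \in t' -> c a != 0 by rewrite mem_t' => /ts; rewrite mem_s.
have [a0 ca0] := nonzero_coef phi_iso cE fnz.
have size_t' : size t' = n.+1.
  rewrite prednK// lt0n size_eq0; apply/eqP => t0.
  have [|y + _] := t_cov a0; first by rewrite mem_s.
  by rewrite -mem_t' t0.
pose e (j : 'I_n.+1) := nth a0 t' j.
have et j : e j \in t' by apply: mem_nth; rewrite size_t'.
have ce j : c (e j) != 0 by exact/ct/et.
have e_inj : injective e.
  move=> i j /eqP; rewrite nth_uniq ?size_t' ?sort_uniq// => /eqP; exact: val_inj.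
have t'_sorted : sorted r t'.
  (* Totality of [r] comes from [meet_total], which concerns nonzero coefficients; hence sorting is
     relative to that predicate. *)
  apply: (@sort_sorted_in _ (fun a => c a != 0)).
    move=> a b ca cb; apply/orP; have [ab|ab] := meet_total c_ok ca cb.
      by left; exact/asboolP.
    by right; exact/asboolP.
  by apply/allP => a /ts; rewrite mem_s.
have e_nest (i j : 'I_n.+1) : (i <= j)%N ->
    (J (e j) : set T) `&` I `<=` (J (e i) : set T) `&` I.
  rewrite leq_eqVlt => /predU1P[/val_inj->//|ij].
  by apply/asboolP; apply: (sorted_ltn_nth r_trans a0 t'_sorted); rewrite ?inE ?size_t'.
(* [u a] is the position of an antichain member above [a]; where [c a = 0] it is the default [ord0],
   and the multiple [q a] is then 0. *)
have [u u_le] : exists u : A -> 'I_n.+1, forall a, c a != 0 -> set_le (J a) (J (e (u a))).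
  suff h a : exists j, c a != 0 -> set_le (J a) (J (e j)).
    by exists (fun a => projT1 (cid (h a))) => a; exact: projT2 (cid (h a)).
  have [ca|ca] := eqVneq (c a) 0.
    by exists ord0.
  have [|y yt /asboolP ay] := t_cov a; first by rewrite mem_s.
  have iy : (index y t' < n.+1)%N by rewrite -size_t' index_mem mem_t'.
  by exists (Ordinal iy) => _; rewrite /e /= nth_index// mem_t'.
pose q a := c a / c (e (u a)).
have q_c a : q a != 0 -> c a != 0.
  by apply: contra_neq; rewrite /q => ->; rewrite mul0r.
have [||||N [theta tP]] := exists_splitting phi_iso cE c_ok (e := e) (r := q) (s := u) e_inj.
- apply: (@sub_finite_set _ _ [set a | c a != 0]); first exact: q_c.
  by apply/finite_seqP; exists s.
- by move=> a /q_c; exact: u_le.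
- exact: ce.
- by move=> a _; rewrite /q divfK.
have [Ndec tiso t1 t2] := tP.
have Sup (j k : 'I_n.+1) : k = j.+1 :> nat -> set_Supset (J (e j)) (J (e k)).
  move=> kj; have neq : e j <> e k.
    by move=> /e_inj jk; move: kj; rewrite jk => /n_Sn.
  apply: (meet_Supset c_ok); [exact: ce|exact: ce|by apply: e_nest; rewrite kj| |].
    by move=> jk; apply/neq/t_anti; rewrite -?mem_t'//; exact/asboolP.
  by move=> kj'; apply/neq/esym/t_anti; rewrite -?mem_t'//; exact/asboolP.
have Mle j : set_le (J (e j)) I := (c_ok (ce j)).1.
have Mmeet j : (J (e j) : set T) `&` I !=set0 := (c_ok (ce j)).2.
exists n, N, (fun j => J (e j)), theta; split.
- apply: (splittingP c_ok ce) tP => j k kj; apply: e_nest; by rewrite kj.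
- exact: Sup.
(* With two summands, the first has a point [a] below the whole second one. The second reaches below
   every point of [I], so [a] would bound [I] from below. *)
- move=> nlb; apply/eqP; rewrite -leqn0 leqNgt; apply/negP => n0.
  have [_ [a [b [_ _ ab]]]] := Sup ord0 (lift ord0 (Ordinal n0)) erefl.
  apply: nlb; exists a => i Ii; have [m Jm mi] := (Mle (lift ord0 (Ordinal n0))).2 i Ii.
  by apply: Order.POrderTheory.le_trans mi; exact/ltW/(ab m Jm).1.
- exists (ker_set Mle ord0) => //.
  by apply: (pm_ker_eqP tiso t1 t2 ce) => j; exact: e_nest.
have Msub (j : 'I_n) :
    (J (e (lift ord0 j)) : set T) `<=` J (e (widen_ord (leqnSn n) j)).
  by apply: (Sup _ _ _).1.
exists (top_set Mle), (step_set Mle); split=> //.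
exact: (pm_coker_isoP tiso t1 t2 ce Mle Mmeet Msub).
Qed.

(** The second conclusion prepares the limit statement: a point of [I] lying in every [Mj j] would
    contradict [coef_fin]. *)
Lemma infinite_splitting : infinite_set [set a | c a != 0] ->
  exists (N : pmod K T) (Mj : nat -> pinterval T)
       (theta : pmor M (pm_sum N (pm_dsum (fun j => interval_mod K (Mj j))))),
     [/\ splitting id f theta,
         forall p, convex_val I p -> exists j, ~ convex_val (Mj j) p &
         exists2 D : convexset T,
           D = (I : set T) `\` Mj 0%N :> set T & pm_ker_eq f D].
Proof.
move=> cinf; pose X := {a : A | c a != 0}.
have rX_trans : transitive (fun x y : X => r (val x) (val y)).
  by move=> y x z; exact: r_trans.
have rX_total : total (fun x y : X => r (val x) (val y)).
  move=> x y; apply/orP; have [h|h] := meet_total c_ok (valP x) (valP y).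
    by left; exact/asboolP.
  by right; exact/asboolP.
have [||e' [e'_inj e'_surj e'_r]] := enumeration rX_trans rX_total.
(* The trace of a predecessor of [b] contains that of [b], hence the point [p]; [coef_fin] at [p]
   leaves finitely many. *)
- move=> b; have [_ [p [Jp Ip]]] := c_ok (valP b).
  have := coef_fin cE Ip.
  move/(finite_preimage (f := val : X -> A)) => /(_ (in2W val_inj)).
  apply: sub_finite_set => x /asboolP xb; split; first exact: (valP x).
  by have [] := xb p (conj Jp Ip).
- move=> /(finite_image (val : X -> A)) Xfin; apply: cinf.
  by apply: sub_finite_set Xfin => a ca; exists (exist _ a ca).
pose e n := val (e' n).
have e_inj : injective e by move=> i j /val_inj/e'_inj.
have ce j : c (e j) != 0 by exact: (valP (e' j)).
have nest j : (J (e j.+1) : set T) `&` I `<=` (J (e j) : set T) `&` I.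
  exact/asboolP/e'_r.
have nest0 j : (J (e j) : set T) `&` I `<=` (J (e 0%N) : set T) `&` I.
  by elim: j => // j IH; exact: subset_trans (nest j) IH.
have Mle j : set_le (J (e j)) I := (c_ok (ce j)).1.
(* The enumeration exhausts the nonzero coefficients, so nothing is subtracted: [r] is zero and [s]
   is arbitrary. *)
have [||||N [theta tP]] := exists_splitting phi_iso cE c_ok (e := e)
  (r := fun=> 0) (s := fun=> 0%N) e_inj.
- by rewrite (_ : [set _ | _] = set0)//; apply/seteqP; split=> a //=; rewrite eqxx.
- by move=> a; rewrite eqxx.
- exact: ce.
- move=> a na; rewrite mul0r; apply/eqP/negPn/negP => ca; apply: na.
  by have [n en] := e'_surj (exist _ a ca); exists n; rewrite /e en.
have [Ndec tiso t1 t2] := tP.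
exists N, (fun j => J (e j)), theta; split.
- by apply: (splittingP c_ok ce) tP => j k ->; exact: nest.
- move=> p Ip; apply: contrapT => nj; apply: infinite_nat.
  have := coef_fin cE Ip; move/(finite_preimage (f := e)) => /(_ (in2W e_inj)).
  apply: sub_finite_set => j _; split; first exact: ce.
  by apply: contrapT => nJ; apply: nj; exists j.
exists (ker_set Mle 0%N) => //.
by apply: (pm_ker_eqP tiso t1 t2 ce) => j; exact: nest0.
Qed.

End Cases.

(** * Suprema and infima in the extended reals *)

Section RealIndices.
Variables (R : realType) (P : set R).

Lemma set_sup_ub (S : set (set_type P)) (p : set_type P) :
  (forall q, S q -> (q <= p)%O) -> (set_sup S <= (\val p)%:E)%E.
Proof. by move=> h; apply: ge_ereal_sup => _ [q Sq <-]; rewrite lee_fin; exact: h. Qed.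

Variables (K : fieldType) (I : pinterval (set_type P)).

(** The suprema decrease, hence converge to their infimum. It is at least the infimum of [I] because
    each [Mj j] meets [I], and at most each [p] in [I] because some [Mj j] avoids [p] and then lies
    entirely below it. *)
Lemma cvg_set_sup (Mj : nat -> pinterval (set_type P)) :
  (forall j, set_le (Mj j) I) ->
  (forall j, (Mj j : set (set_type P)) `&` I !=set0) ->
  (forall j, (Mj j.+1 : set (set_type P)) `&` I `<=` (Mj j : set (set_type P)) `&` I) ->
  (forall p, convex_val I p -> exists j, ~ convex_val (Mj j) p) ->
  set_sup (Mj j) @[j --> \oo] --> set_inf I.
Proof.
move=> Mle Mmeet nest Mout.
have mono : nonincreasing_seq (fun j => set_sup (Mj j)).
  apply/nonincreasing_seqP => j; apply: ge_ereal_sup => _ [q Mq <-].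
  have [z [Mz Iz]] := Mmeet j.+1.
  (* Nesting is known for traces on [I] alone: if [q] is below [z], take [z]; otherwise [q] is
     itself in [I] and in the trace. *)
  have [y [My qy]] : exists y, convex_val (Mj j) y /\ (q <= y)%O.
    case: (leP q z) => [qz|/ltW zq]; first by exists z; have [] := nest j z (conj Mz Iz).
    have Iq : convex_val I q.
      by have [i Ii qi] := (Mle j.+1).1 q Mq; exact: convexP Iz Ii zq qi.
    by exists q; have [] := nest j q (conj Mq Iq).
  by apply: (@le_trans _ _ (\val y)%:E); [rewrite lee_fin|apply: ereal_sup_ubound; exists y].
have := ereal_nonincreasing_cvgn mono; congr (_ --> _).
apply/eqP; rewrite eq_le; apply/andP; split.
  apply: le_ereal_inf_tmp => _ [p Ip <-]; have [j nMp] := Mout p Ip.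
  apply: (@le_trans _ _ (set_sup (Mj j))); first by apply: ereal_inf_lbound; exists j.
  apply: set_sup_ub => q Mq; case: (leP q p) => // /ltW pq; case: nMp.
  by have [m Mm mp] := (Mle j).2 p Ip; exact: convexP Mm Mq mp pq.
apply: le_ereal_inf_tmp => _ [j _ <-]; have [z [Mz Iz]] := Mmeet j.
by apply: (@le_trans _ _ (\val z)%:E);
  [apply: ereal_inf_lbound|apply: ereal_sup_ubound]; exists z.
Qed.

End RealIndices.

Theorem theorem1p9 (R : realType) (P : set R) (K : fieldType)
    (M : pmod K (set_type P)) (I : pinterval (set_type P))
    (f : pmor (interval_mod K I) M) :
  interval_decomposable M -> pm_nonzero f ->
  (* case (1), with n.+1 summands *)
  ((exists (n : nat) (N : pmod K (set_type P)) (Mj : 'I_n.+1 -> pinterval (set_type P))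
       (theta : pmor M (pm_sum N (pm_dsum (fun j => interval_mod K (Mj j))))),
     [/\ splitting (@nat_of_ord n.+1) f theta,
         forall j k : 'I_n.+1, k = j.+1 :> nat -> set_Supset (Mj j) (Mj k),
         ~ has_lower_bound I -> n = 0%N,
         exists2 D : convexset (set_type P),
           D = (I : set (set_type P)) `\` Mj ord0 :> set (set_type P) &
           pm_ker_eq f D &
         exists (D : convexset (set_type P)) (E : 'I_n -> convexset (set_type P)),
           [/\ D = (Mj ord_max : set (set_type P)) `\` I :> set (set_type P),
               forall j : 'I_n,
                 E j = (Mj (widen_ord (leqnSn n) j) : set (set_type P)) `\`
                   (((Mj (widen_ord (leqnSn n) j) : set (set_type P)) `\`
                     Mj (lift ord0 j)) `&` I) :> set (set_type P) &
               pm_iso (pm_coker f)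
                 (pm_sum N (pm_sum (interval_mod K D)
                   (pm_dsum (fun j => interval_mod K (E j)))))]])
  \/
  (* case (2) *)
   (exists (N : pmod K (set_type P)) (Mj : nat -> pinterval (set_type P))
       (theta : pmor M (pm_sum N (pm_dsum (fun j => interval_mod K (Mj j))))),
     [/\ splitting id f theta,
         set_sup (Mj j) @[j --> \oo] --> set_inf I &
         exists2 D : convexset (set_type P),
           D = (I : set (set_type P)) `\` Mj 0%N :> set (set_type P) &
           pm_ker_eq f D]))
  /\
  (* case (2) cannot occur when [inf I] belongs to [I] *)
  (inf_attained I ->
   forall (N : pmod K (set_type P)) (Mj : nat -> pinterval (set_type P))
     (theta : pmor M (pm_sum N (pm_dsum (fun j => interval_mod K (Mj j))))),
     ~ splitting id f theta).
Proof.
move=> [A [J [phi phi_iso]]] fnz; split; last first.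
  move=> [p Ip infp] N Mj theta.
  apply: (least_no_infinite_splitting Ip) => q Iq.
  have : (set_inf I <= (\val q)%:E)%E by apply: ereal_inf_lbound; exists q.
  by rewrite infp lee_fin.
have [c [cE c_ok]] := interval_sum_morP f phi.
(* [{classic A}] gives the index type the choice structure required by lists and sorting. *)
pose J' : {classic A} -> pinterval (set_type P) := J.
have [cfin|cinf] := pselect (finite_set [set a | c a != 0]).
  by left; exact: (@finite_splitting _ _ _ _ _ _ {classic A} J' phi phi_iso c cE c_ok fnz cfin).
right; have [N [Mj [theta [spl Mout kerf]]]] :=
  @infinite_splitting _ _ _ _ _ _ {classic A} J' phi phi_iso c cE c_ok cinf.
exists N, Mj, theta; split=> //; have [_ _ _ Mok nest] := spl.
apply: cvg_set_sup => // [j|j|j]; [by have [] := Mok j|by have [] := Mok j|exact: nest].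
Qed.
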